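(* Let $m,n>1$ be integers such that $\mathbb{Z}_n$ is a $\mathbb{Z}_m$-module (equivalently, $n\mid m$). Then the graph $G_n(\mathbb{Z}_m)$ is outerplanar if and only if there exist pairwise distinct primes $p_1,p_2,p_3$ and positive integers $\alpha_1,\alpha_2,\beta_1$ (only those occurring in the respective item being relevant) such that one of the following holds: (1) $m=p_1^{\alpha_1}$, $n=p_1^{\beta_1}$ and $\beta_1\leq 4$; (2) $m=p_1^{\alpha_1}p_2^{\alpha_2}$, $n=p_1$ and $\alpha_2\leq 3$; (3) $m=p_1^{\alpha_1}p_2$, $n=p_1^{2}$; (4) $m=p_1^{\alpha_1}p_2p_3$, $n=p_1$; (5) $m=p_1p_2^{\alpha_2}$, $n=p_1p_2^{2}$ and $\alpha_2\in\{2,3\}$; (6) $m=p_1p_2p_3$, $n=p_1p_2$; (7) $m=p_1^{\alpha_1}p_2^{\alpha_2}$, $n=p_1p_2$ and $\alpha_1,\alpha_2\leq 3$; (8) $m=n=p_1p_2p_3$.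
   Context: $\mathbb{Z}_k$ denotes the ring (or additive group) of integers modulo $k$. For integers $m,n>1$, $\mathbb{Z}_n$ is a $\mathbb{Z}_m$-module (with the natural action) if and only if $n$ divides $m$. Let $I(\mathbb{Z}_m)^*$ be the set of all non-zero proper ideals of $\mathbb{Z}_m$. The $\mathbb{Z}_n$-intersection graph of $\mathbb{Z}_m$, denoted $G_n(\mathbb{Z}_m)$, is the simple graph with vertex set $I(\mathbb{Z}_m)^*$ in which two distinct vertices $I,J$ are adjacent if and only if $I\mathbb{Z}_n\cap J\mathbb{Z}_n\neq 0$. An undirected graph is outerplanar if it can be drawn in the plane without crossings in such a way that all of the vertices belong to the unbounded face of the drawing; equivalently (a known characterization), it contains no subdivision of $K_4$ or $K_{2,3}$. The graph with no vertices (which occurs when $m$ is prime) is allowed and counts as outerplanar. *)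

(* Defs.v *)
From HB Require Import structures.
From mathcomp Require Import all_boot all_order all_algebra all_fingroup.
From mathcomp Require Import all_classical all_reals all_analysis.

Set Implicit Arguments.
Unset Strict Implicit.
Unset Printing Implicit Defensive.

Import Order.TTheory GRing.Theory Num.Theory.
Import numFieldNormedType.Exports.

Record sgraph := SGraph {
  svertex :> finType;
  sadj : rel svertex;
  sadj_sym : symmetric sadj;
  sadj_irrefl : irreflexive sadj }.

Section IntersectionGraph.
Variables (n m : nat).

(* [idealr_closed] includes [1 \notin I], i.e. it describes proper ideals. *)
Definition nonzero_proper_ideal (I : {set 'Z_m}) : bool :=
  `[< idealr_closed I >] && (I != [set 0%R]%SET).

Definition ideal_vertex := {I : {set 'Z_m} | nonzero_proper_ideal I}.

(* The natural action of Z_m on Z_n; it is a module structure iff n divides m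
   (for m, n > 1). *)
Definition nat_act (a : 'Z_m) (x : 'Z_n) : 'Z_n := ((a : nat)%:R * x)%R.

(* I Z_n is the set of finite sums of products a x with a in I, x in Z_n.
   The group law on 'Z_n used by << _ >> is its addition. *)
Definition ideal_mul (I : {set 'Z_m}) : {set 'Z_n} :=
  <<[set nat_act a x | a in I, x in [set: 'Z_n]]%SET>>%g.

Definition inter_adj (I J : ideal_vertex) : bool :=
  (I != J) && (ideal_mul (val I) :&: ideal_mul (val J) != [set 0%R]%SET).

Lemma inter_adj_sym : symmetric inter_adj.
Proof. by move=> I J; rewrite /inter_adj eq_sym finset.setIC. Qed.

Lemma inter_adj_irrefl : irreflexive inter_adj.
Proof. by move=> I; rewrite /inter_adj eqxx. Qed.

Definition intersection_graph : sgraph :=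
  SGraph inter_adj_sym inter_adj_irrefl.

End IntersectionGraph.

Section Outerplanar.
Variable R : realType.
Local Open Scope ring_scope.
Local Open Scope classical_set_scope.

Definition is_arc (p q : R * R) (A : set (R * R)) : Prop :=
  exists f : R -> R * R,
    [/\ {within `[0, 1], continuous f}, {in `[0, 1] &, injective f},
        f 0 = p, f 1 = q & A = f @` `[0, 1]].

(* A drawing without crossings; [arc u v] is only meaningful when u and v are
   adjacent. *)
Record drawing (G : sgraph) := Drawing {
  pos : G -> R * R;
  arc : G -> G -> set (R * R);
  pos_inj : injective pos;
  arc_sym : forall u v, sadj u v -> arc u v = arc v u;
  arcP : forall u v, sadj u v -> is_arc (pos u) (pos v) (arc u v);
  arc_vertex : forall u v w, sadj u v -> arc u v (pos w) -> w = u \/ w = v;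
  arc_noncrossing : forall u v x y z, sadj u v -> sadj x y ->
    ~ ((u = x /\ v = y) \/ (u = y /\ v = x)) ->
    arc u v z -> arc x y z -> exists w, z = pos w }.

Definition drawn (G : sgraph) (D : drawing G) : set (R * R) :=
  [set z | (exists v, z = pos D v) \/
           (exists u v, sadj u v /\ arc D u v z)].

Definition is_face (G : sgraph) (D : drawing G) (F : set (R * R)) : Prop :=
  exists2 z, (~` drawn D) z & F = connected_component (~` drawn D) z.

(* A vertex belongs to a face when it lies on its boundary, i.e. in its
   closure (faces being disjoint from the drawing). *)
Definition outerplanar (G : sgraph) : Prop :=
  exists (D : drawing G) (F : set (R * R)),
    [/\ is_face D F, ~ bounded_set F & forall v : G, closure F (pos D v)].

End Outerplanar.

(* Main.v *)
Require Import Defs.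
From mathcomp Require Import all_boot all_order all_algebra all_fingroup.
From mathcomp Require Import all_classical all_reals all_analysis.
From mathcomp Require Import ring lra zify.

Import Order.TTheory GRing.Theory Num.Theory.
Import numFieldNormedType.Exports.

Set Implicit Arguments.
Unset Strict Implicit.
Unset Printing Implicit Defensive.

(** An ideal of Z_m is dZ_m for a divisor d of m (its label), and it generates
gcd(d, n)Z_n inside Z_n.  Two such subgroups, for d and e, meet in lcm(gcd(d, n), gcd(e, n))Z_n,
which is nonzero iff some prime p has v_p(d) < v_p(n) and v_p(e) < v_p(n) ([inter_adjP]).  So the
graph is a union of cliques S_p = {d | v_p(d) < v_p(n), d <> 1}, one for each prime p dividing n,
plus isolated vertices.  If m = p^a e with p prime to e and v_p(n) = b, then S_p has
b tau(e) - 1 elements, tau counting divisors.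

An outerplanar graph has no four pairwise adjacent vertices ([K4_not_outerplanar]), which gives
b tau(e) <= 4 for each p ([divisors_bound]); these inequalities leave exactly the eight families
([listed_of_bounds]).  Conversely, each family has at most three cliques S_p, each of at most three
elements, consecutive ones meeting in at most one vertex.  Such cliques can be laid out along a
line so that no two edges cross, and edges drawn above the line leave the lower half plane in a
face that touches every vertex ([noncrossing_outerplanar], [sun_outerplanar],
[outerplanar_of_listed]).

The topological core is that K4 is not outerplanar when edges are arbitrary continuous arcs.
The total turning of a closed triangle around a point is locally
constant off the triangle and is 0 far away, hence it is 0 on an unbounded connected set that
misses the triangle, and also at points of its closure off the triangle ([tri_turn_face]).  If all
four vertices touched the unbounded face, every triangle would therefore have turning 0 around
the opposite vertex.  For disjoint edges f and g, the vector g(t) - f(s) never vanishes on the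
unit square, so it has a continuous argument there, whose increments along the four sides cancel
([turn_square]).  Each increment is a difference of arguments of vectors between vertices plus a
multiple of 2 pi.  The four triangles and the three pairs of disjoint edges thus give seven linear
relations between twelve integers; added up modulo 2 they read 0 = 1, because the argument of
q - p differs from that of p - q by pi ([K4_turning_parity]).  This is the planar case of the
Radon-van Kampen parity obstruction. *)

(** * Arguments of plane vectors *)
Section Angle.
Variable R : realType.
Local Open Scope classical_set_scope. Local Open Scope ring_scope.
Implicit Types (u v w z : R * R) (a b d t : R).

Definition dot u v := u.1 * v.1 + u.2 * v.2.
Definition cross u v := u.1 * v.2 - u.2 * v.1.
Definition is_arg u a := exists2 r, 0 < r & u = (r * cos a, r * sin a).
(** The oriented angle from u to v, correct as long as it is acute. *)
Definition angle u v := atan (cross u v / dot u v).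

Lemma cosDint2pi a (k : int) : cos (a + k%:~R * (pi *+ 2)) = cos a.
Proof.
case: k => n; first by rewrite -pmulrn mulr_natl (periodicn (@cosD2pi R)).
rewrite -[in RHS](subrK (n.+1%:R * (pi *+ 2)) a) mulr_natl.
rewrite (periodicn (@cosD2pi R)); congr cos; rewrite NegzE mulrNz.
by rewrite mulNr -pmulrn mulr_natl.
Qed.

Lemma cos_eq1 a : cos a = 1 -> exists k : int, a = k%:~R * (pi *+ 2).
Proof.
move=> ca1; have pi0 := pi_gt0 R.
have pp : 0 < pi *+ 2 :> R by rewrite pmulrn_lgt0.
exists (Num.floor (a / (pi *+ 2))); set k := Num.floor _.
have /andP[] := floor_itv (a / (pi *+ 2)); rewrite -/k => k1 k2.
pose b := a - k%:~R * (pi *+ 2).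
have b0 : 0 <= b by rewrite subr_ge0 -ler_pdivlMr.
have b1 : b < pi *+ 2.
  by rewrite ltrBlDr -[X in X + _]mul1r -mulrDl addrC -ltr_pdivrMr // -intrD1.
have cb : cos b = 1 by rewrite /b -mulNr -mulrNz cosDint2pi.
suff : b = 0 by move/eqP; rewrite subr_eq0 => /eqP.
pose c := b / 2; have bc : b = c *+ 2 by rewrite /c -mulr_natr; field.
have : sin c = 0.
  have := cos2Dsin2 c; move: cb; rewrite bc cos_mulr2n => h1 h2.
  by apply/eqP; rewrite -sqrf_eq0; apply/eqP; lra.
apply: contra_eq => bn0; apply: lt0r_neq0; apply: sin_gt0_pi; apply/andP; split.
  by rewrite divr_gt0 // lt_neqAle eq_sym bn0.
by rewrite /c ltr_pdivrMr // mulr_natr.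
Qed.

Lemma is_arg_diff u a b : is_arg u a -> is_arg u b ->
  exists k : int, a = b + k%:~R * (pi *+ 2).
Proof.
case=> r r0 -> [s s0] [e1 e2].
have ha := cos2Dsin2 a; have hb := cos2Dsin2 b.
have h1 : r * cos (a - b) = s.
  have -> : r * cos (a - b) = r * cos a * cos b + r * sin a * sin b.
    by rewrite cosB; ring.
  by rewrite e1 e2 -[RHS]mulr1 -hb; ring.
have h2 : s * cos (a - b) = r.
  have -> : s * cos (a - b) = cos a * (s * cos b) + sin a * (s * sin b).
    by rewrite cosB; ring.
  by rewrite -e1 -e2 -[RHS]mulr1 -ha; ring.
have [k abk] : exists k : int, a - b = k%:~R * (pi *+ 2).
  apply: cos_eq1; have [c0|c0] := ltP 0 (cos (a - b)); last first.
    by move: (mulr_ge0_le0 (ltW r0) c0); rewrite h1 leNgt s0.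
  apply/eqP; rewrite -(pexpr_eq1 (n := 2)) ?ltW //; apply/eqP.
  by apply: (mulfI (lt0r_neq0 r0)); rewrite mulr1 expr2 mulrA h1 h2.
by exists k; rewrite -abk addrC subrK.
Qed.

Lemma is_argN u a : is_arg u a -> is_arg (- u) (a + pi).
Proof.
case=> r r0 ->; exists r => //; rewrite sinDpi cosDpi.
by rewrite !mulrN.
Qed.

(** Rotating by an acute angle: v is a positive multiple of u turned by the
arctangent of cross / dot.  It carries arguments along small steps. *)
Lemma is_arg_dot u v a : is_arg u a -> 0 < dot u v -> is_arg v (a + angle u v).
Proof.
case=> r r0 ->; rewrite /dot /angle /cross /= => duv.
set c := (r * cos a * v.2 - r * sin a * v.1) in duv *.
set d := (r * cos a * v.1 + r * sin a * v.2) in duv *.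
have [q q0 cq] : exists2 q, 0 < q & cos (atan (c / d)) = q^-1.
  by rewrite cos_atan; eexists; [|reflexivity]; rewrite sqrtr_gt0 ltr_pwDl // sqr_ge0.
have ha := cos2Dsin2 a.
have sq : sin (atan (c / d)) = c / d * q^-1.
  have := atanK (c / d); rewrite /tan cq => {2}<-.
  by rewrite divfK // invr_neq0 // lt0r_neq0.
exists (d * q / r); first by rewrite divr_gt0 // mulr_gt0.
have dn := lt0r_neq0 duv; have rn := lt0r_neq0 r0; have qn := lt0r_neq0 q0.
rewrite cosD sinD cq sq [v]surjective_pairing; congr pair; apply/esym.
- have -> : d * q / r * (cos a / q - sin a * (c / d / q)) = (d * cos a - c * sin a) / r.
    by field; rewrite dn qn rn.
  by rewrite /c /d /= -[RHS]mulr1 -ha; field; exact: rn.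
- have -> : d * q / r * (sin a / q + cos a * (c / d / q)) = (d * sin a + c * cos a) / r.
    by field; rewrite dn qn rn.
  by rewrite /c /d /= -[RHS]mulr1 -ha; field; exact: rn.
Qed.

Lemma dot_gt0 u : u != 0 -> 0 < dot u u.
Proof.
rewrite /dot -!expr2 => u0.
rewrite lt_neqAle addr_ge0 ?sqr_ge0 // andbT eq_sym paddr_eq0 ?sqr_ge0 //.
by rewrite !sqrf_eq0; apply: contra u0; case: u => p q /= /andP[/eqP-> /eqP->].
Qed.

(** Every nonzero vector makes an acute angle with one of the four axis
directions, whose arguments are known. *)
Lemma is_arg_exists u : u != 0 -> exists a, is_arg u a.
Proof.
move=> u0.
have arg0 a : is_arg (cos a, sin a) a by exists 1 => //; rewrite !mul1r.
have step a : 0 < dot (cos a, sin a) u -> exists b, is_arg u b.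
  by move=> h; eexists; apply: is_arg_dot h.
have := step (- (pi / 2)); have := step (pi / 2); have := step pi; have := step 0.
rewrite sin0 cos0 sinpi cospi sinN cosN cos_pihalf sin_pihalf /dot /=.
rewrite !(mul0r, mul1r, addr0, add0r, mulN1r, oppr_gt0) => h1 h2 h3 h4.
have [/h2//|/h1//|u1] := ltgtP u.1 0.
have [/h4//|/h3//|u2] := ltgtP u.2 0.
by move: u0; rewrite [u]surjective_pairing u1 u2 eqxx.
Qed.

End Angle.

(** * Continuous arguments over the unit square *)
Section Lift.
Variable R : realType.
Local Open Scope classical_set_scope. Local Open Scope ring_scope.
Implicit Types (u v w z : R * R) (a b d t : R).

(** Uniformity over a compact set, as used twice below: for uniformly small
steps in a subdivision, and for small displacements of a base point. *)
Lemma compact_near_gt0 (T V : topologicalType) (K : set T) (v0 : V)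
    (h : T * V -> R) : compact K ->
  (forall x, K x -> {for (x, v0), continuous h}) ->
  (forall x, K x -> 0 < h (x, v0)) ->
  \forall y \near v0, forall x, K x -> 0 < h (x, y).
Proof.
move=> /compact_near_coveringP cK hc h0.
apply: (cK V (nbhs v0) (fun y x => 0 < h (x, y)) _) => x Kx.
have hx := h0 _ Kx; have := hc _ Kx _ (lt_nbhsr hx).
by case=> AB hAB sAB; exists AB => // -[x1 y1] /sAB.
Qed.

Lemma continuous_fst (T : topologicalType) (f : T -> R * R) x :
  {for x, continuous f} -> {for x, continuous (fun y => (f y).1)}.
Proof. by move=> cf; apply: continuous_comp; [exact: cf|exact: cvg_fst]. Qed.

Lemma continuous_snd (T : topologicalType) (f : T -> R * R) x :
  {for x, continuous f} -> {for x, continuous (fun y => (f y).2)}.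
Proof. by move=> cf; apply: continuous_comp; [exact: cf|exact: cvg_snd]. Qed.

Lemma continuous_pair (T : topologicalType) (f g : T -> R) x :
  {for x, continuous f} -> {for x, continuous g} ->
  {for x, continuous (fun y => (f y, g y))}.
Proof. by move=> cf cg; have := @cvg_pair _ _ _ _ _ _ _ _ _ _ _ cf cg; exact. Qed.

Lemma continuous_dot (T : topologicalType) (f g : T -> R * R) x :
  {for x, continuous f} -> {for x, continuous g} ->
  {for x, continuous (fun x => dot (f x) (g x))}.
Proof.
by move=> cf cg; apply: cvgD; apply: cvgM;
  (exact: continuous_fst || exact: continuous_snd).
Qed.

Lemma continuous_cross (T : topologicalType) (f g : T -> R * R) x :
  {for x, continuous f} -> {for x, continuous g} ->
  {for x, continuous (fun x => cross (f x) (g x))}.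
Proof.
by move=> cf cg; apply: cvgB; apply: cvgM;
  (exact: continuous_fst || exact: continuous_snd).
Qed.

Lemma continuous_angle (T : topologicalType) (f g : T -> R * R) x :
  0 < dot (f x) (g x) ->
  {for x, continuous f} -> {for x, continuous g} ->
  {for x, continuous (fun x => angle (f x) (g x))}.
Proof.
move=> h cf cg; apply: continuous_comp; last exact: continuous_atan.
apply: cvgM; first exact: continuous_cross.
by apply: cvgV; [rewrite gt_eqF|exact: continuous_dot].
Qed.

(** Precomposing with [clamp] turns a path on the unit interval into a path on
the whole line with the same values, which removes relative continuity from the
argument. *)
Definition clamp t : R := Num.max 0 (Num.min t 1).

Lemma clamp_continuous : continuous clamp.
Proof.
move=> t; apply: (@continuous_max R R (fun=> 0) (fun t => Num.min t 1)); first exact: cst_continuous.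
by apply: (@continuous_min R R id (fun=> 1)); [exact: cvg_id|exact: cst_continuous].
Qed.

Lemma clamp_itv t : 0 <= clamp t <= 1.
Proof. by rewrite /clamp le_max lexx ge_max ler01 ge_min lexx orbT. Qed.

Lemma clamp_id t : 0 <= t <= 1 -> clamp t = t.
Proof. by case/andP => t0 t1; rewrite /clamp min_l // max_r. Qed.

Definition unit_square : set (R * R) := `[0, 1] `*` `[0, 1].

Lemma compact_square : compact unit_square.
Proof. by apply: compact_setX; exact: segment_compact. Qed.

(** Walk from the origin to x in N equal steps, with N so large that F turns by an
acute angle at each step, and add up the angles.  The sum is continuous in x
because each term is. *)
Lemma lift_square (F : R * R -> R * R) : continuous F -> (forall x, F x != 0) ->
  exists2 th : R * R -> R, continuous th & forall x, unit_square x -> is_arg (F x) (th x).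
Proof.
move=> cF F0.
have /nbhs_ballP[e /= e0 he] : \forall v \near (0 : R * R), forall x, unit_square x ->
    0 < dot (F x) (F (x + v)).
  apply: (compact_near_gt0 (h := fun p => dot (F p.1) (F (p.1 + p.2)))).
  - exact: compact_square.
  - move=> x _; apply: continuous_dot.
      by apply: continuous_comp; [exact: cvg_fst|exact: cF].
    apply: continuous_comp; last exact: cF.
    by apply: cvgD; [exact: cvg_fst|exact: cvg_snd].
  - by move=> x _; rewrite /= addr0; exact: dot_gt0.
pose N := (Num.truncn e^-1).+1.
have N0 : 0 < N%:R :> R by rewrite ltr0n.
have Ne : N%:R^-1 < e.
  by rewrite -[ltRHS]invrK ltf_pV2 ?posrE ?invr_gt0 // truncnS_gt.
pose c x : R * R := (clamp x.1, clamp x.2).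
have sc x : unit_square (c x) by split; rewrite /= in_itv /=; exact: clamp_itv.
have cid x : unit_square x -> c x = x.
  by case: x => p q [] /=; rewrite !in_itv /= => ? ?; congr pair; apply: clamp_id.
have cc : continuous c.
  move=> x; apply: (@continuous_pair _ (fun y => clamp y.1) (fun y => clamp y.2));
    apply: continuous_comp; try exact: clamp_continuous.
    exact: cvg_fst.
  exact: cvg_snd.
have sz k x : unit_square x -> (k < N)%N -> unit_square ((k%:R / N%:R) *: x).
  case: x => p q [] /=; rewrite !in_itv /= => /andP[? ?] /andP[? ?] kN.
  have k1 : 0 <= (k%:R / N%:R : R) <= 1.
    by rewrite divr_ge0 ?ler0n //= ler_pdivrMr // mul1r ler_nat ltnW.
  by case/andP: k1 => ? ?; split; rewrite /= in_itv /=; apply/andP;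
    (split; [exact: mulr_ge0|exact: mulr_ile1]).
have step k x : unit_square x -> (k < N)%N ->
    0 < dot (F ((k%:R / N%:R) *: x)) (F ((k.+1%:R / N%:R) *: x)).
  move=> sx kN; have -> : (k.+1%:R / N%:R) *: x = (k%:R / N%:R) *: x + N%:R^-1 *: x.
    by rewrite -scalerDl -natr1 mulrDl mul1r.
  apply: he; last exact: sz.
  rewrite -ball_normE /= sub0r normrN normrZ.
  apply: le_lt_trans Ne; rewrite (@ger0_norm _ N%:R^-1) ?invr_ge0 ?ler0n //.
  rewrite ger_pMr ?invr_gt0 //.
  case: x sx => p q [] /=; rewrite !in_itv /= => /andP[? ?] /andP[? ?].
  by rewrite /Num.norm /= ge_max !ger0_norm //; apply/andP.
have [a0 ha0] := is_arg_exists (F0 0).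
pose th x := a0 + \sum_(k < N) angle (F ((k%:R / N%:R) *: c x)) (F ((k.+1%:R / N%:R) *: c x)).
exists th.
- move=> x; apply: cvgD; first exact: cvg_cst.
  apply: (@cvg_big R _ +%R 0 xpredT); first exact: add_continuous.
  move=> k _.
  apply: continuous_angle; first exact: step.
    by apply: continuous_comp; [apply: cvgZr; exact: cc|exact: cF].
  by apply: continuous_comp; [apply: cvgZr; exact: cc|exact: cF].
- move=> x sx; rewrite /th (cid _ sx).
  have : forall n, (n <= N)%N -> is_arg (F ((n%:R / N%:R) *: x)) (a0 + \sum_(k < n) angle (F ((k%:R / N%:R) *: x)) (F ((k.+1%:R / N%:R) *: x))).
    elim=> [|n IH] nN; first by rewrite mul0r scale0r big_ord0 addr0.
    rewrite big_ord_recr /= addrA; apply: is_arg_dot; first exact: IH (ltnW nN).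
    exact: step.
  by move=> /(_ N (leqnn _)); rewrite divff ?scale1r // gt_eqF.
Qed.
End Lift.

(** * Turning of a path around a point *)
Section Turn.
Variable R : realType.
Local Open Scope classical_set_scope. Local Open Scope ring_scope.
Implicit Types (u v w z : R * R) (a b d t : R) (f g h : R -> R * R).

Definition in01 t := 0 <= t <= 1.

(** The total turning over the unit interval of a path that avoids 0. *)
Definition turn f d := exists th : R -> R,
  [/\ forall t, in01 t -> {for t, continuous th},
      forall t, in01 t -> is_arg (f t) (th t) & th 1 - th 0 = d].

Lemma in01_0 : in01 0. Proof. by rewrite /in01 lexx ler01. Qed.
Lemma in01_1 : in01 1. Proof. by rewrite /in01 lexx ler01. Qed.

(** Two continuous arguments differ by a continuous function with values in
2 pi Z; were it not constant, it would take a value that is an odd multiple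
of pi. *)
Lemma turn_uniq f d d' : turn f d -> turn f d' -> d = d'.
Proof.
case=> th [cth ath <-] [th' [cth' ath' <-]].
pose e t := th t - th' t.
have ce : {within `[0, 1], continuous e}.
  apply: continuous_in_subspaceT => t; rewrite inE /= in_itv => ht.
  by apply: cvgB; [exact: cth|exact: cth'].
have ez t : in01 t -> exists k : int, e t = k%:~R * (pi *+ 2).
  move=> ht; have [k E] := is_arg_diff (ath t ht) (ath' t ht).
  by exists k; rewrite /e E addrC addKr.
have [k0 E0] := ez 0 in01_0; have [k1 E1] := ez 1 in01_1.
suff k01 : k0 = k1 by move: E0 E1; rewrite /e k01 => <-; lra.
have pp := pi_gt0 R; have qE : pi *+ 2 = pi * 2 :> R by rewrite mulr_natr.
pose m := Num.min k0 k1.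
apply/eqP/negPn/negP => k01.
have [|c hc ec] := IVT (v := m%:~R * (pi *+ 2) + pi) (ler01 : (0:R) <= 1) ce.
  rewrite E0 E1 qE; apply/andP.
  have P (i j : int) : i < j ->
      i%:~R * ((pi : R) * 2) <= i%:~R * ((pi : R) * 2) + (pi : R) <= j%:~R * ((pi : R) * 2).
    move=> ij; have {ij} : i + 1 <= j by lia.
    rewrite -(ler_int R) intrD => ij.
    by apply/andP; split; nra.
  rewrite /m; have [lt|gt|eq] := ltgtP k0 k1; last by rewrite eq eqxx in k01.
    by have /andP[h1 h2] := P _ _ lt; split; [rewrite ge_min h1|rewrite le_max h2 orbT].
  by have /andP[h1 h2] := P _ _ gt; split; [rewrite ge_min h1 orbT|rewrite le_max h2].
rewrite in_itv /= in hc; have [j ej] := ez c hc.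
have : ((j - m) * 2)%:~R = 1%:~R :> R.
  rewrite ec in ej; apply: (mulIf (lt0r_neq0 pp)).
  rewrite intrM intrB mul1r; move: ej; rewrite qE => ej.
  lra.
by move/eqP; rewrite eqr_int => /eqP; lia.
Qed.

Lemma turn_exists f : continuous f -> (forall t, in01 t -> f t != 0) ->
  exists d, turn f d.
Proof.
move=> cf f0.
have [||th cth ath] := @lift_square R (fun x => f (clamp x.1)).
- move=> x; apply: continuous_comp; last exact: cf.
  by apply: continuous_comp; [exact: cvg_fst|exact: clamp_continuous].
- by move=> x; apply: f0; exact: clamp_itv.
exists (th (1, 0) - th (0, 0)), (fun t => th (t, 0)); split => // t ht.
  apply: (@continuous_comp _ _ _ (fun t => (t, 0)) th); last exact: cth.
  by apply: (@continuous_pair _ _ id (fun=> 0)); [exact: cvg_id|exact: cvg_cst].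
rewrite -[X in is_arg (f X)](clamp_id ht); apply: (ath (t, 0)).
by split => /=; rewrite in_itv //= lexx ler01.
Qed.

(** Two paths that stay at an acute angle turn by the same amount up to the angles
at the ends. *)
Lemma turn_dot f g d : turn f d -> continuous f -> continuous g ->
  (forall t, in01 t -> 0 < dot (f t) (g t)) ->
  turn g (d + angle (f 1) (g 1) - angle (f 0) (g 0)).
Proof.
case=> th [cth ath <-] cf cg fg; exists (fun t => th t + angle (f t) (g t)).
split => [t ht|t ht|]; last by ring.
  by apply: cvgD; [exact: cth|apply: continuous_angle; [exact: fg|exact: cf|exact: cg]].
by apply: is_arg_dot; [exact: ath|exact: fg].
Qed.

Lemma turn_cst u : u != 0 -> turn (fun=> u) 0.
Proof.
move=> /is_arg_exists[a ha]; exists (fun=> a); split => //; last by rewrite subrr.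
by move=> t _; exact: cvg_cst.
Qed.

Definition avoids f z := forall t, in01 t -> f t != z.

(** Meaningful when f avoids z. *)
Definition turn_around f z := xget 0 [set d | turn (fun t => f t - z) d].

Lemma continuousB f z : continuous f -> continuous (fun t => f t - z).
Proof. by move=> cf t; apply: cvgB; [exact: cf|exact: cvg_cst]. Qed.

Lemma turn_aroundE f z d : turn (fun t => f t - z) d -> turn_around f z = d.
Proof. by move=> h; apply: xget_unique => // d' /turn_uniq; exact. Qed.

Lemma turn_aroundP f z : continuous f -> avoids f z ->
  turn (fun t => f t - z) (turn_around f z).
Proof.
move=> cf fz; have [|t /fz|d hd] := @turn_exists (fun t => f t - z).
- exact: continuousB.
- by rewrite subr_eq0.
- by rewrite (turn_aroundE hd).
Qed.

Lemma turn_around_arg f z a b : continuous f -> avoids f z ->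
  is_arg (f 0 - z) a -> is_arg (f 1 - z) b ->
  exists k : int, turn_around f z = b - a + k%:~R * (pi *+ 2).
Proof.
move=> cf fz ha hb; have [th [_ ath <-]] := turn_aroundP cf fz.
have [k Ek] := is_arg_diff (ath _ in01_0) ha.
have [l El] := is_arg_diff (ath _ in01_1) hb.
by exists (l - k); rewrite Ek El intrB; ring.
Qed.

(** The correction depends only on the end points of f, so it cancels around a
closed polygon of paths. *)
Lemma turn_around_near f z : continuous f -> avoids f z ->
  \forall z' \near z, avoids f z' /\
   turn_around f z' = turn_around f z
     + angle (f 1 - z) (f 1 - z') - angle (f 0 - z) (f 0 - z').
Proof.
move=> cf fz.
have : \forall z' \near z, forall t, [set` `[0, 1]] t -> 0 < dot (f t - z) (f t - z').
  apply: (@compact_near_gt0 R R (R * R)%type [set` `[0, 1]] z (fun p => dot (f p.1 - z) (f p.1 - p.2))).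
  - exact: segment_compact.
  - move=> t _; apply: continuous_dot; apply: cvgB.
    + by apply: continuous_comp; [exact: cvg_fst|exact: cf].
    + exact: cvg_cst.
    + by apply: continuous_comp; [exact: cvg_fst|exact: cf].
    + exact: cvg_snd.
  - by move=> t /=; rewrite in_itv /= => ht; apply: dot_gt0; rewrite subr_eq0; exact: fz.
apply: filterS => z' hz.
have hz' t : in01 t -> 0 < dot (f t - z) (f t - z') by move=> ht; apply: hz; rewrite /= in_itv.
split.
  move=> t /hz'; apply: contraTneq => ->.
  by rewrite /dot subrr /= !mulr0 addr0 ltxx.
apply: turn_aroundE; apply: (turn_dot (turn_aroundP cf fz)) => //; exact: continuousB.
Qed.

(** Far from f, every vector f t - z makes an acute angle with the constant - z,
whose turning is 0. *)
Lemma turn_around_far f : continuous f -> exists M, forall z, M < `|z| ->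
  turn_around f z = angle (- z) (f 1 - z) - angle (- z) (f 0 - z).
Proof.
move=> cf.
have cn : {within `[0, 1], continuous (fun t => `|f t|)}.
  by apply: continuous_subspaceT => t; apply: cvg_norm; exact: cf.
have [c _ hc] := EVT_max (ler01 : (0:R) <= 1) cn.
exists (2 * `|f c|) => z hz.
apply: turn_aroundE; rewrite -[X in turn _ X]add0r addrA.
apply: (@turn_dot (fun=> - z)).
- by apply: turn_cst; rewrite oppr_eq0 -normr_gt0; apply: le_lt_trans hz; rewrite mulr_ge0.
- by move=> t; exact: cvg_cst.
- exact: continuousB.
- move=> t ht; have : `|f t| <= `|f c| by apply: hc; rewrite in_itv.
  move=> ft; have fz : 2 * `|f t| < `|z| by apply: le_lt_trans hz; rewrite ler_pM2l.
  move: (f t) fz => [p q]; case: z {hz} => x y; rewrite /dot /= {1 2}/Num.norm /=.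
  rewrite /ProdNormedZmodule.norm /= => hn.
  have xp : x * p <= `|x| * `|p| by rewrite -normrM ler_norm.
  have yq : y * q <= `|y| * `|q| by rewrite -normrM ler_norm.
  have -> : - x * (p - x) + - y * (q - y) = x ^+ 2 + y ^+ 2 - x * p - y * q by ring.
  rewrite -(real_normK (num_real x)) -(real_normK (num_real y)).
  move: xp yq (normr_ge0 x) (normr_ge0 y) (normr_ge0 p) (normr_ge0 q) hn.
  move: `|x| `|y| `|p| `|q| (x * p) (y * q) => a b P Q u v; clear.
  move=> hu hv a0 b0 P0 Q0.
  case: (leP a b) => ab; case: (leP P Q) => PQ hn; nra.
Qed.

(** For f from a to b, g from b to c and h from a to c this is the turning of the
closed triangle abc around z. *)
Definition tri_turn f g h z := turn_around f z + turn_around g z - turn_around h z.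

Section Triangle.
Variables (f g h : R -> R * R).
Hypotheses (cf : continuous f) (cg : continuous g) (ch : continuous h).
Hypotheses (fg : f 1 = g 0) (gh : g 1 = h 1) (fh : f 0 = h 0).

Lemma tri_turn_near z : avoids f z -> avoids g z -> avoids h z ->
  \forall z' \near z, tri_turn f g h z' = tri_turn f g h z.
Proof.
move=> fz gz hz; near=> z'; rewrite /tri_turn.
have [|_ ->] := near (turn_around_near cf fz) z' => //.
have [|_ ->] := near (turn_around_near cg gz) z' => //.
have [|_ ->] := near (turn_around_near ch hz) z' => //.
by rewrite fg gh fh; ring.
Unshelve. all: by end_near. Qed.

Lemma tri_turn_far : exists M, forall z, M < `|z| -> tri_turn f g h z = 0.
Proof.
have [M1 h1] := turn_around_far cf; have [M2 h2] := turn_around_far cg.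
have [M3 h3] := turn_around_far ch.
exists (Num.max M1 (Num.max M2 M3)) => z; rewrite !gt_max => /and3P[z1 z2 z3].
by rewrite /tri_turn (h1 _ z1) (h2 _ z2) (h3 _ z3) fg gh fh; ring.
Qed.

(** The subset of F where the turning vanishes is nonempty, by [tri_turn_far], and
both open and closed in F, by [tri_turn_near]. *)
Lemma tri_turn_face (F : set (R * R)) v : connected F -> ~ bounded_set F ->
  (forall z, F z -> [/\ avoids f z, avoids g z & avoids h z]) ->
  closure F v -> avoids f v -> avoids g v -> avoids h v ->
  tri_turn f g h v = 0.
Proof.
move=> cF uF aF Fv fv gv hv.
have [z [Fz /= <-]] := Fv _ (tri_turn_near fv gv hv).
have [M hM] := tri_turn_far.
pose Z := [set z | F z -> tri_turn f g h z = 0].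
pose N := [set z | F z -> tri_turn f g h z <> 0].
have near_eq z1 : F z1 -> \forall z' \near z1, tri_turn f g h z' = tri_turn f g h z1.
  by move=> /aF[? ? ?]; exact: tri_turn_near.
have FZ z1 : F z1 -> Z^° z1 <-> tri_turn f g h z1 = 0.
  move=> Fz1; split=> [/nbhs_singleton/(_ Fz1)//|z10].
  by apply: filterS (near_eq _ Fz1) => z2 /= E Fz2; rewrite E.
have FN z1 : F z1 -> N^° z1 <-> tri_turn f g h z1 <> 0.
  move=> Fz1; split=> [/nbhs_singleton/(_ Fz1)//|z10].
  by apply: filterS (near_eq _ Fz1) => z2 /= E Fz2; rewrite E.
(* F `&` Z^° is also the trace on F of the closed set ~` N^°. *)
have BF : F `&` Z^° = F.
  apply: cF.
  - have [z1 [Fz1 Mz1]] : exists z1, F z1 /\ M < `|z1|.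
      apply: contrapT => noz; apply: uF; exists M; split; first exact: num_real.
      move=> x Mx z1 Fz1 /=; apply: le_trans (ltW Mx); rewrite leNgt.
      by apply/negP => ?; apply: noz; exists z1.
    by exists z1; split => //; apply/FZ => //; exact: hM.
  - by exists Z^° => //; exact: open_interior.
  - exists (~` N^°); first by apply: open_closedC; exact: open_interior.
    apply/seteqP; split => z1 [Fz1 hz1]; split => //.
      by move/FN => /(_ Fz1); apply; exact/FZ.
    by apply/FZ => //; apply: contrapT => /FN-/(_ Fz1).
by apply/FZ => //; rewrite -BF in Fz; case: Fz.
Qed.
End Triangle.

(** All four turnings are increments, along the sides of the unit square, of one
argument of g t - f s; each corner value occurs twice, with opposite signs. *)
Lemma turn_square f g : continuous f -> continuous g ->
  (forall s t, in01 s -> in01 t -> f s != g t) ->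
  turn_around g (f 1) - turn_around g (f 0) = turn_around f (g 1) - turn_around f (g 0).
Proof.
move=> cf cg fg.
have [||th cth ath] := @lift_square R (fun x => g (clamp x.2) - f (clamp x.1)).
- move=> x; apply: cvgB.
    apply: continuous_comp; last exact: cg.
    by apply: continuous_comp; [exact: cvg_snd|exact: clamp_continuous].
  apply: continuous_comp; last exact: cf.
  by apply: continuous_comp; [exact: cvg_fst|exact: clamp_continuous].
- move=> x; rewrite subr_eq0 eq_sym; apply: fg; exact: clamp_itv.
have cid t : in01 t -> clamp t = t by exact: clamp_id.
have G s : in01 s -> turn_around g (f s) = th (s, 1) - th (s, 0).
  move=> hs; apply: turn_aroundE; exists (fun t => th (s, t)); split => // t ht.
    apply: (@continuous_comp _ _ _ (fun t => (s, t)) th); last exact: cth.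
    by apply: (@continuous_pair _ _ (fun=> s) id); [exact: cvg_cst|exact: cvg_id].
  rewrite -[X in g X]cid // -[X in f X]cid //; apply: (ath (s, t)).
  by split; rewrite /= in_itv.
have F t : in01 t -> turn_around f (g t) = th (1, t) - th (0, t).
  move=> ht; apply: turn_aroundE; exists (fun s => th (s, t) + pi); split => [s hs|s hs|].
  - apply: cvgD; last exact: cvg_cst.
    apply: (@continuous_comp _ _ _ (fun s => (s, t)) th); last exact: cth.
    by apply: (@continuous_pair _ _ id (fun=> t)); [exact: cvg_id|exact: cvg_cst].
  - rewrite -opprB; apply: is_argN.
    rewrite -[X in g X]cid // -[X in f X]cid //; apply: (ath (s, t)).
    by split; rewrite /= in_itv.
  - by ring.
rewrite !G ?F ?in01_0 ?in01_1 //; ring.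
Qed.

(** The hypotheses are those of a K4 whose triangles all have turning 0 around the
opposite vertex.  Choose an argument x_pq of q - p for p before q, and x_pq + pi
for p - q.  Each of the twelve turnings of an edge around a vertex off it is then
a difference of two of these, plus 2 pi times an integer k_i.  The chosen arguments
cancel in the triangles and in two of the pairs of disjoint edges; in the
remaining pair, ac and bd, they leave 2 pi. *)
Lemma K4_turning_parity (a b c d : R * R) (ab ac ad bc bd cd : R -> R * R)
  (cab : continuous ab) (cac : continuous ac) (cad : continuous ad)
  (cbc : continuous bc) (cbd : continuous bd) (ccd : continuous cd)
  (ab0 : ab 0 = a) (ab1 : ab 1 = b) (ac0 : ac 0 = a) (ac1 : ac 1 = c)
  (ad0 : ad 0 = a) (ad1 : ad 1 = d) (bc0 : bc 0 = b) (bc1 : bc 1 = c)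
  (bd0 : bd 0 = b) (bd1 : bd 1 = d) (cd0 : cd 0 = c) (cd1 : cd 1 = d)
  (abcd : forall s t, in01 s -> in01 t -> ab s != cd t)
  (acbd : forall s t, in01 s -> in01 t -> ac s != bd t)
  (adbc : forall s t, in01 s -> in01 t -> ad s != bc t)
  (ta : tri_turn bc cd bd a = 0) (tb : tri_turn ac cd ad b = 0)
  (tc : tri_turn ab bd ad c = 0) (td : tri_turn ab bc ac d = 0) : 
  a != b -> a != c -> a != d -> b != c -> b != d -> c != d -> False.
Proof.
have s1 := turn_square cab ccd abcd; have s2 := turn_square cac cbd acbd.
have s3 := turn_square cad cbc adbc.
have av f g p t : (forall s t, in01 s -> in01 t -> f s != g t) -> in01 t -> g t = p -> avoids f p.
  by move=> fg ht <- s hs; exact: fg.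
have av' f g p t : (forall s t, in01 s -> in01 t -> f s != g t) -> in01 t -> f t = p -> avoids g p.
  by move=> fg ht <- s hs; rewrite eq_sym; exact: fg.
have K f z p q al be : continuous f -> f 0 = p -> f 1 = q -> avoids f z ->
    is_arg (p - z) al -> is_arg (q - z) be ->
    exists k : int, turn_around f z = be - al + k%:~R * (pi *+ 2).
  by move=> cf <- <-; exact: turn_around_arg.
move=> nab nac nad nbc nbd ncd.
have A (p q : R * R) : p != q ->
    exists al : R, is_arg (q - p) al /\ is_arg (p - q) (al + pi).
  move=> npq; have [|al hal] := @is_arg_exists R (q - p).
    by rewrite subr_eq0 eq_sym.
  by exists al; split => //; rewrite -opprB; exact: is_argN.
have [xab [hab hba]] := A _ _ nab. have [xac [hac hca]] := A _ _ nac.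
have [xad [had hda]] := A _ _ nad. have [xbc [hbc hcb]] := A _ _ nbc.
have [xbd [hbd hdb]] := A _ _ nbd. have [xcd [hcd hdc]] := A _ _ ncd.
have [k1 e1] := K _ _ _ _ _ _ cab ab0 ab1 (av _ _ _ _ abcd in01_0 cd0) hca hcb.
have [k2 e2] := K _ _ _ _ _ _ cab ab0 ab1 (av _ _ _ _ abcd in01_1 cd1) hda hdb.
have [k3 e3] := K _ _ _ _ _ _ ccd cd0 cd1 (av' _ _ _ _ abcd in01_0 ab0) hac had.
have [k4 e4] := K _ _ _ _ _ _ ccd cd0 cd1 (av' _ _ _ _ abcd in01_1 ab1) hbc hbd.
have [k5 e5] := K _ _ _ _ _ _ cac ac0 ac1 (av _ _ _ _ acbd in01_0 bd0) hba hbc.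
have [k6 e6] := K _ _ _ _ _ _ cac ac0 ac1 (av _ _ _ _ acbd in01_1 bd1) hda hdc.
have [k7 e7] := K _ _ _ _ _ _ cbd bd0 bd1 (av' _ _ _ _ acbd in01_0 ac0) hab had.
have [k8 e8] := K _ _ _ _ _ _ cbd bd0 bd1 (av' _ _ _ _ acbd in01_1 ac1) hcb hcd.
have [k9 e9] := K _ _ _ _ _ _ cad ad0 ad1 (av _ _ _ _ adbc in01_0 bc0) hba hbd.
have [k10 e10] := K _ _ _ _ _ _ cad ad0 ad1 (av _ _ _ _ adbc in01_1 bc1) hca hcd.
have [k11 e11] := K _ _ _ _ _ _ cbc bc0 bc1 (av' _ _ _ _ adbc in01_0 ad0) hab hac.
have [k12 e12] := K _ _ _ _ _ _ cbc bc0 bc1 (av' _ _ _ _ adbc in01_1 ad1) hdb hdc.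
move: s1 s2 s3 ta tb tc td; rewrite /tri_turn ab0 ab1 ac0 ac1 ad0 ad1 bc0 bc1 bd0 bd1 cd0 cd1.
rewrite e1 e2 e3 e4 e5 e6 e7 e8 e9 e10 e11 e12 -[pi *+ 2]mulr_natr.
have pp := pi_gt0 R => s1 s2 s3 ta tb tc td.
have key (k : int) : k%:~R * (pi : R) = 0 -> k = 0.
  by move/eqP; rewrite mulf_eq0 (gt_eqF pp) orbF intr_eq0 => /eqP.
have {}s1 : k4 - k3 - k2 + k1 = 0.
  by apply: key; rewrite !(intrD, intrB); lra.
have {}s2 : (k8 - k7 - k6 + k5) * 2 - 2 = 0.
  by apply: key; rewrite !(intrD, intrB, intrM); lra.
have {}s3 : k12 - k11 - k10 + k9 = 0.
  by apply: key; rewrite !(intrD, intrB); lra.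
have {}ta : k11 + k3 - k7 = 0 by apply: key; rewrite !(intrD, intrB); lra.
have {}tb : k5 + k4 - k9 = 0 by apply: key; rewrite !(intrD, intrB); lra.
have {}tc : k1 + k8 - k10 = 0 by apply: key; rewrite !(intrD, intrB); lra.
have {}td : k2 + k12 - k6 = 0 by apply: key; rewrite !(intrD, intrB); lra.
(* Each k_i occurs once in s1, s2, s3 and once in ta, tb, tc, td: modulo 2 its
   total is 1 by the former and 0 by the latter. *)
lia.
Qed.
End Turn.

(** * The complete graph on four vertices *)
Section K4.
Variable R : realType.
Local Open Scope classical_set_scope. Local Open Scope ring_scope.

Lemma is_arc_path (p q : R * R) A : is_arc p q A ->
  exists f : R -> R * R, [/\ continuous f, f 0 = p, f 1 = q & forall t, A (f t)].
Proof.
case=> f [cf _ f0 f1 ->]; exists (f \o clamp (R := R)).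
have ci (t : R) : `[0, 1]%classic (clamp t) by rewrite /= in_itv; exact: clamp_itv.
split; rewrite /=.
- move=> t; apply: (@cvg_comp _ _ _ _ _ _ (within `[0, 1] (nbhs (clamp t)))).
    move=> B; rewrite /within /= => hB.
    apply: (@filterS _ (nbhs t) _ _ _ _ (clamp_continuous hB)) => s /= h.
    by apply: h; exact: ci.
  by apply: (subspace_continuousP _ f).1.
- by rewrite clamp_id ?lexx ?ler01.
- by rewrite clamp_id ?lexx ?ler01.
- move=> t; exists (clamp t) => //; exact: ci.
Qed.

(** All vertices touch one unbounded connected set that misses every edge, so
[tri_turn_face] applies to the four triangles and [K4_turning_parity] gives the
contradiction. *)
Lemma K4_not_outerplanar (G : sgraph) (a b c d : G) :
  sadj a b -> sadj a c -> sadj a d -> sadj b c -> sadj b d -> sadj c d ->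
  ~ outerplanar R G.
Proof.
move=> hab hac had hbc hbd hcd [D [F [[z0 Dz0 ->] uF vF]]].
have adjN u v : @sadj G u v -> u <> v by move=> h E; rewrite E sadj_irrefl in h.
have nab := adjN _ _ hab; have nac := adjN _ _ hac; have nad := adjN _ _ had.
have nbc := adjN _ _ hbc; have nbd := adjN _ _ hbd; have ncd := adjN _ _ hcd.
have path u v (h : @sadj G u v) := is_arc_path (arcP D h).
have [ab [cab ab0 ab1 Aab]] := path _ _ hab.
have [ac [cac ac0 ac1 Aac]] := path _ _ hac.
have [ad [cad ad0 ad1 Aad]] := path _ _ had.
have [bc [cbc bc0 bc1 Abc]] := path _ _ hbc.
have [bd [cbd bd0 bd1 Abd]] := path _ _ hbd.
have [cd [ccd cd0 cd1 Acd]] := path _ _ hcd.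
have disj u v x y (f g : R -> R * R) : @sadj G u v -> @sadj G x y ->
    u <> x -> u <> y -> v <> x -> v <> y ->
    (forall t, Defs.arc D u v (f t)) -> (forall t, Defs.arc D x y (g t)) ->
    forall s t, in01 s -> in01 t -> f s != g t.
  move=> uv xy ux uy vx vy Af Ag s t _ _; apply/eqP => E.
  have [w Ew] : exists w, f s = pos D w.
    by apply: (arc_noncrossing uv xy _ (Af s)); [case=> -[]|rewrite E].
  have := Af s; have := Ag t; rewrite -E Ew.
  by move=> /(arc_vertex xy)[]-> /(arc_vertex uv)[]/esym.
have off u v w (f : R -> R * R) : @sadj G u v -> w <> u -> w <> v ->
    (forall t, Defs.arc D u v (f t)) -> avoids f (pos D w).
  by move=> uv wu wv Af t _; apply/eqP => E; have := Af t; rewrite E => /(arc_vertex uv)[].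
have face u v (f : R -> R * R) z : @sadj G u v -> (forall t, Defs.arc D u v (f t)) ->
    connected_component (~` drawn D) z0 z -> avoids f z.
  move=> uv Af /connected_component_sub nz t _; apply/eqP => E; apply: nz.
  by right; exists u, v; rewrite -E.
have cF := @component_connected _ (~` drawn D) z0.
have posN u v : u <> v -> pos D u != pos D v by move=> uv; apply/eqP => /pos_inj.
have tri (f g h : R -> R * R) (x y z w : G) : continuous f -> continuous g -> continuous h ->
    f 0 = pos D x -> f 1 = pos D y -> g 0 = pos D y -> g 1 = pos D z ->
    h 0 = pos D x -> h 1 = pos D z ->
    @sadj G x y -> @sadj G y z -> @sadj G x z ->
    (forall t, Defs.arc D x y (f t)) -> (forall t, Defs.arc D y z (g t)) -> (forall t, Defs.arc D x z (h t)) ->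
    w <> x -> w <> y -> w <> z -> tri_turn f g h (pos D w) = 0.
  move=> kf kg kh f0 f1 g0 g1 h0 h1 xy yz xz Af Ag Ah wx wy wz.
  apply: (tri_turn_face kf kg kh _ _ _ cF uF); rewrite ?f1 ?g1 ?f0 //.
  - by move=> p Fp; split; [exact: face xy Af Fp|exact: face yz Ag Fp|exact: face xz Ah Fp].
  - exact: off xy wx wy Af.
  - exact: off yz wy wz Ag.
  - exact: off xz wx wz Ah.
have sy (u v : G) : u <> v -> v <> u by move=> h /esym.
apply: (K4_turning_parity cab cac cad cbc cbd ccd ab0 ab1 ac0 ac1 ad0 ad1 bc0 bc1 bd0 bd1 cd0 cd1);
  try (apply: posN; by []).
- by apply: disj hab hcd _ _ _ _ Aab Acd.
- by apply: disj hac hbd _ _ _ _ Aac Abd => //; exact: sy.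
- by apply: disj had hbc _ _ _ _ Aad Abc => //; exact: sy.
- exact: (tri _ _ _ b c d a).
- by apply: (tri _ _ _ a c d b) => //; exact: sy.
- by apply: (tri _ _ _ a b d c) => //; exact: sy.
- by apply: (tri _ _ _ a b c d) => //; exact: sy.
Qed.
End K4.

(** * One-page book embeddings *)
Section Book.
Variable R : realType.
Local Open Scope classical_set_scope. Local Open Scope ring_scope.

(** The arc y = (x - p)(q - x) above the segment from p to q on the x-axis.  It is
the chord of a parabola, sheared so that the parabola becomes the axis; hence
nested humps behave as chords of a convex curve do.  The condition 0 <= y encodes
that x lies between p and q without ordering these two. *)
Definition hump (p q : R) : set (R * R) :=
  [set z | z.2 = (z.1 - p) * (q - z.1) /\ 0 <= z.2].

Definition hump_path (p q t : R) : R * R := (p + (q - p) * t, (q - p) ^+ 2 * (t * (1 - t))).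

Lemma hump_sym p q : hump p q = hump q p.
Proof. by apply/seteqP; split => -[x y] [/= -> y0]; split => //=; ring. Qed.

Lemma hump_path_continuous p q : continuous (hump_path p q).
Proof.
move=> t; apply: (@continuous_pair _ _ (fun t => p + (q - p) * t)
  (fun t => (q - p) ^+ 2 * (t * (1 - t)))).
  apply: cvgD; first exact: cvg_cst.
  by apply: cvgM; [exact: cvg_cst|exact: cvg_id].
apply: cvgM; first exact: cvg_cst.
apply: cvgM; first exact: cvg_id.
by apply: cvgB; [exact: cvg_cst|exact: cvg_id].
Qed.

Lemma hump_is_arc p q : p != q -> is_arc (p, 0) (q, 0) (hump p q).
Proof.
move=> pq; have qp : q - p != 0 by rewrite subr_eq0 eq_sym.
exists (hump_path p q); split.
- by apply: continuous_subspaceT; exact: hump_path_continuous.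
- by move=> s t _ _ [/addrI/(mulfI qp)].
- by rewrite /hump_path; congr pair; ring.
- by rewrite /hump_path; congr pair; ring.
- apply/seteqP; split => [[x y] [/= yE y0]|_ [t t01 <-]].
  + pose t := (x - p) / (q - p).
    have xE : x = p + (q - p) * t by rewrite /t; field.
    have yE' : y = (q - p) ^+ 2 * (t * (1 - t)) by rewrite yE xE; ring.
    exists t; last by rewrite /hump_path -xE -yE'.
    have q2 : 0 < (q - p) ^+ 2 by rewrite lt_neqAle sqr_ge0 eq_sym sqrf_eq0 qp.
    have tt : 0 <= t * (1 - t) by rewrite -(pmulr_rge0 _ q2) -yE'.
    by rewrite /= in_itv /=; apply/andP; split; nra.
  + move: t01; rewrite /= in_itv /= => /andP[t0 t1]; split; rewrite /=; first by ring.
    by rewrite mulr_ge0 ?sqr_ge0 // mulr_ge0 // subr_ge0.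
Qed.

Lemma hump_base p q x : hump p q (x, 0) -> x = p \/ x = q.
Proof.
case=> /= /esym/eqP; rewrite mulf_eq0 !subr_eq0 => /orP[/eqP->|/eqP->] _; by [left|right].
Qed.

(** If the bases do not interleave they are nested, and then the outer hump is
strictly above the inner one wherever the inner one is off the axis, unless the
two coincide. *)
Lemma hump_meet p q r s x y : p < q -> r < s -> hump p q (x, y) -> hump r s (x, y) ->
  y <> 0 -> ~ ((p < r) && (r < q) /\ q < s) -> ~ ((r < p) && (p < s) /\ s < q) -> p = r /\ q = s.
Proof.
move=> pq rs [/= e1 y0] [/= e2 _] yn n1 n2.
have {y0 yn} y0 : 0 < y by rewrite lt_neqAle y0 andbT eq_sym; apply/eqP.
have px : p < x by rewrite ltNge; apply/negP => h; nra.
have xq : x < q by rewrite ltNge; apply/negP => h; nra.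
have rx : r < x by rewrite ltNge; apply/negP => h; nra.
have xs : x < s by rewrite ltNge; apply/negP => h; nra.
have e : (x - p) * (q - x) = (x - r) * (s - x) by rewrite -e1.
have [pr|rp|pr] := ltgtP p r.
- have sq : s <= q.
    by rewrite leNgt; apply/negP => qs; apply: n1; rewrite pr (lt_trans rx xq).
  nra.
- have qs : q <= s.
    by rewrite leNgt; apply/negP => sq; apply: n2; rewrite rp (lt_trans px xs).
  nra.
- by split => //; move: e; rewrite pr => /mulfI h; apply: (addIr (- x)); apply: h; rewrite gt_eqF ?subr_gt0.
Qed.

Definition lower_half : set (R * R) := [set z | z.2 < 0].

Lemma connected_lower_half : connected lower_half.
Proof.
pose sg (z : R * R) (t : R) : R * R := (t * z.1, (1 - t) * (-1) + t * z.2).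
pose seg (z : R * R) := sg z @` `[0, 1].
have csg z : continuous (sg z).
  move=> t; apply: (@continuous_pair R R (fun t => t * z.1) (fun t => (1 - t) * (-1) + t * z.2)).
    by apply: cvgM; [exact: cvg_id|exact: cvg_cst].
  apply: cvgD; apply: cvgM; try exact: cvg_cst; try exact: cvg_id.
  by apply: cvgB; [exact: cvg_cst|exact: cvg_id].
have segc z : connected (seg z).
  apply: connected_continuous_connected; first exact/connected_intervalP/interval_is_interval.
  exact: continuous_subspaceT.
have -> : lower_half = \bigcup_(z in lower_half) seg z.
  apply/seteqP; split => [z hz|_ [z hz [t + <-]]].
    exists z => //; exists 1; first by rewrite /= in_itv /= ler01 lexx.
    by rewrite /sg !mul1r subrr mul0r add0r -surjective_pairing.
  move: hz; rewrite /lower_half /sg /= in_itv /= => hz /andP[t0 t1]; nra.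
apply: bigcup_connected => //; exists (0, -1) => z hz; exists 0.
  by rewrite /= in_itv /= ler01 lexx.
by rewrite /sg !mul0r subr0 addr0 mul1r.
Qed.

(** Vertices lie on the x-axis in the order given by i and edges are humps above
it.  The open lower half plane misses the drawing and has every vertex in its
closure. *)
Lemma noncrossing_outerplanar (G : sgraph) (i : G -> nat) : injective i ->
  (forall u v x y : G, sadj u v -> sadj x y ->
     ~ [/\ (i u < i x)%N, (i x < i v)%N & (i v < i y)%N]) ->
  outerplanar R G.
Proof.
move=> i_inj nc.
pose ps (v : G) : R * R := ((i v)%:R, 0).
have ps_inj : injective ps by move=> u v [/eqP]; rewrite eqr_nat => /eqP/i_inj.
pose ar (u v : G) := hump (i u)%:R (i v)%:R.
have iN u v : @sadj G u v -> i u != i v.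
  by apply: contraTneq => /i_inj ->; rewrite sadj_irrefl.
have ar_sym (u v : G) : sadj u v -> ar u v = ar v u by move=> _; exact: hump_sym.
have arP u v : @sadj G u v -> is_arc (ps u) (ps v) (ar u v).
  by move=> /iN uv; apply: hump_is_arc; rewrite eqr_nat.
have arv u v w : @sadj G u v -> ar u v (ps w) -> w = u \/ w = v.
  move=> uv /hump_base[] /eqP; rewrite eqr_nat => /eqP/i_inj ->; by [left|right].
have meet u v x y z : @sadj G u v -> @sadj G x y -> (i u < i v)%N -> (i x < i y)%N ->
    ar u v z -> ar x y z -> z.2 <> 0 -> u = x /\ v = y.
  case: z => a b uv xy luv lxy h1 h2 b0.
  have [||||E1 E2] := hump_meet _ _ h1 h2 b0; rewrite ?ltr_nat //.
  - by case=> /andP[? ?] ?; apply: (nc _ _ _ _ uv xy).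
  - by case=> /andP[? ?] ?; apply: (nc _ _ _ _ xy uv).
  - move/eqP: E1; move/eqP: E2; rewrite !eqr_nat => /eqP/i_inj -> /eqP/i_inj ->.
    by [].
have arN u v x y z : @sadj G u v -> @sadj G x y ->
    ~ ((u = x /\ v = y) \/ (u = y /\ v = x)) ->
    ar u v z -> ar x y z -> exists w, z = ps w.
  move=> uv xy ne h1 h2.
  have [z0|z0] := pselect (z.2 = 0).
    case: z z0 h1 {h2} => a b /= -> /hump_base[]->; by [exists u|exists v].
  exfalso; apply: ne.
  have vu : sadj v u by rewrite sadj_sym.
  have yx : sadj y x by rewrite sadj_sym.
  have h1' : ar v u z by rewrite ar_sym.
  have h2' : ar y x z by rewrite ar_sym.
  have [luv|lvu|/eqP] := ltngtP (i u) (i v); last by rewrite (negbTE (iN _ _ uv)).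
    have [lxy|lyx|/eqP] := ltngtP (i x) (i y); last by rewrite (negbTE (iN _ _ xy)).
      by left; exact: meet z0.
    by right; exact: meet z0.
  have [lxy|lyx|/eqP] := ltngtP (i x) (i y); last by rewrite (negbTE (iN _ _ xy)).
    by have [] := meet _ _ _ _ _ vu xy lvu lxy h1' h2 z0; right.
  by have [] := meet _ _ _ _ _ vu yx lvu lyx h1' h2' z0; left.
pose D := Drawing ps_inj ar_sym arP arv arN.
have lowerD : lower_half `<=` ~` drawn D.
  move=> z z0 [[v zE]|[u [v [_ [_ z1]]]]]; move: z0; rewrite /lower_half /=.
    by rewrite zE ltxx.
  by rewrite ltNge z1.
pose F := connected_component (~` drawn D) (0, -1).
have low1 : lower_half (0, -1) by rewrite /lower_half /= oppr_lt0 ltr01.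
have lowerF : lower_half `<=` F by apply: connected_component_max => //; exact: connected_lower_half.
exists D, F; split.
- by exists (0, -1) => //; exact: lowerD.
- case=> M [_ /(_ (`|M| + 1))]; rewrite ltr_pwDr ?ler_norm // => /(_ isT).
  move=> /(_ (0, - (`|M| + 2)))/=.
  have h : F (0, - (`|M| + 2)).
    by apply: lowerF; rewrite /lower_half /= oppr_lt0 ltr_wpDl.
  move=> /(_ h); rewrite prod_normE /= normrN ge_max => /andP[_].
  by rewrite ger0_norm ?addr_ge0 //; lra.
- move=> v; apply: (closureS lowerF) => B /nbhs_ballP[e /= e0 he].
  exists ((i v)%:R, - (e / 2)); split; first by rewrite /lower_half /= oppr_lt0 divr_gt0.
  apply: he; split; rewrite /= /ball /= ?subrr ?normr0 //.
  by rewrite sub0r opprK ger0_norm ?divr_ge0 ?ltW // gtr_pMr // invf_lt1 // ltr1n.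
Qed.
End Book.

(** * Three small cliques arranged in a ring *)
(** The vertices, known by their labels d, are numbered z, A, x, B, y, C, then the
rest: each clique occupies an interval of the resulting ring and neighbouring
intervals share only x, y or z.  So edges of different cliques cannot interleave,
and inside a clique interleaving would take four vertices.  With C empty this
covers two cliques sharing a vertex. *)
Lemma sun_outerplanar (R : realType) (G : sgraph) (d : G -> nat)
    (A B C : seq nat) (x y z : nat) :
  injective d -> size A <= 3 -> size B <= 3 -> size C <= 3 ->
  (forall w, w \in A -> w \in B -> w = x) ->
  (forall w, w \in B -> w \in C -> w = y) ->
  (forall w, w \in C -> w \in A -> w = z) ->
  y \notin A -> z \notin B -> x \notin C ->
  (forall u v : G, sadj u v ->
    [\/ d u \in A /\ d v \in A, d u \in B /\ d v \in B | d u \in C /\ d v \in C]) ->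
  outerplanar R G.
Proof.
move=> d_inj sA sB sC AB BC CA yA zB xC cov.
(* z gets 0, A gets 1 to 3, x gets 4, B gets 5 to 7, y gets 8, C gets 9 to 11;
   g decodes. *)
pose i w := if w == z then 0 else if w == x then 4 else if w == y then 8
  else if w \in A then (index w A).+1 else if w \in B then 5 + index w B
  else if w \in C then 9 + index w C else 12 + w.
pose g n := if n == 0 then z else if n == 4 then x else if n == 8 then y
  else if n < 4 then nth 0 A n.-1 else if n < 8 then nth 0 B (n - 5)
  else if n < 12 then nth 0 C (n - 9) else n - 12.
have ix (D : seq nat) w : size D <= 3 -> w \in D ->
    index w D < 3 /\ nth 0 D (index w D) = w.
  by move=> sD wD; rewrite nth_index // (leq_trans _ sD) ?index_mem.
have i_inj : injective i.
  apply: (can_inj (g := g)) => w; rewrite /i.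
  case: eqP => [->//|_]; case: eqP => [->//|_]; case: eqP => [->//|_].
  case: ifP => [/(ix _ _ sA)[]|_]; first by case: (index w A) => [|[|[|]]].
  case: ifP => [/(ix _ _ sB)[]|_]; first by case: (index w B) => [|[|[|]]].
  case: ifP => [/(ix _ _ sC)[]|_]; first by case: (index w C) => [|[|[|]]].
  by rewrite /g addKn.
have iA w : w \in A -> i w <= 4.
  move=> wA; have [h _] := ix _ _ sA wA; rewrite /i wA.
  case: eqP => // _; case: eqP => // _; case: eqP => [wy|_]; last by lia.
  by rewrite -wy wA in yA.
have iB w : w \in B -> 4 <= i w <= 8.
  move=> wB; have [h _] := ix _ _ sB wB; rewrite /i wB.
  case: eqP => [wz|_]; first by rewrite -wz wB in zB.
  case: eqP => // wx; case: eqP => // _; case: ifP => [/AB/(_ wB)//|_]; lia.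
have iC w : w \in C -> i w = 0 \/ 8 <= i w.
  move=> wC; have [h _] := ix _ _ sC wC; rewrite /i wC.
  case: eqP => [|wz]; first by left.
  case: eqP => [wx|_]; first by rewrite -wx wC in xC.
  right; case: eqP => // wy; case: ifP => [/(CA _ wC)//|_].
  by case: ifP => [/BC/(_ wC)//|_]; lia.
have four (D : seq nat) a b c e : size D <= 3 -> a \in D -> b \in D -> c \in D -> e \in D ->
    ~ [/\ i a < i b, i b < i c & i c < i e].
  move=> sD ha hb hc he [ab bc ce].
  have n w w' : i w < i w' -> w != w' by apply: contraTneq => ->; rewrite ltnn.
  have u : uniq [:: a; b; c; e] by rewrite /= !inE !negb_or !n //; lia.
  have sub : {subset [:: a; b; c; e] <= D} by move=> w; rewrite !inE => /or4P[]/eqP->.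
  by have /leq_trans/(_ sD) := uniq_leq_size u sub.
apply: (@noncrossing_outerplanar R G (i \o d)); first exact: inj_comp i_inj d_inj.
move=> u v x' y' /cov uv /cov xy' [/= ux xv vy].
case: uv xy' => -[uD vD] [] [xD yD]; try by apply: (four _ _ _ _ _ _ uD xD vD yD).
- by have := iA _ vD; have := iB _ xD; lia.
- by have := iA _ vD; case: (iC _ xD); lia.
- by have := iB _ uD; have := iA _ xD; lia.
- by have := iB _ uD; have := iB _ vD; case: (iC _ xD); lia.
- by have := iA _ yD; case: (iC _ vD); lia.
- by have := iB _ xD; have := iB _ yD; case: (iC _ vD); lia.
Qed.

Lemma two_cliques_outerplanar (R : realType) (G : sgraph) (d : G -> nat)
    (A B : seq nat) (x : nat) :
  injective d -> size A <= 3 -> size B <= 3 -> 0 \notin A -> 0 \notin B ->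
  (forall w, w \in A -> w \in B -> w = x) ->
  (forall u v : G, sadj u v -> d u \in A /\ d v \in A \/ d u \in B /\ d v \in B) ->
  outerplanar R G.
Proof.
move=> d_inj sA sB A0 B0 AB cov.
apply: (@sun_outerplanar R G d A B [::] x 0 0) => // u v /cov[]; by [constructor 1|constructor 2].
Qed.

(** * The intersection graph in terms of divisors *)
Section Zm.
Variables (m : nat) (hm : 1 < m).

Lemma Zp_natE (x : 'Z_m) : x = (x : nat)%:R%R.
Proof. by rewrite natr_Zp. Qed.

Lemma val_ZpD (x y : 'Z_m) : val (x + y)%R = (x + y) %% m.
Proof. by rewrite /=; congr (_ %% _); exact: Zp_cast. Qed.

Lemma val_ZpM (x y : 'Z_m) : val (x * y)%R = (x * y) %% m.
Proof. by rewrite /=; congr (_ %% _); exact: Zp_cast. Qed.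

Lemma ltn_Zm (x : 'Z_m) : x < m.
Proof. by apply: leq_trans (ltn_ord x) _; rewrite Zp_cast. Qed.

Definition multiples (d : nat) : {set 'Z_m} := [set x : 'Z_m | d %| x]%SET.

Lemma dvdn_modm d k : d %| m -> (d %| k %% m) = (d %| k).
Proof. by move=> dm; rewrite /dvdn modn_dvdm. Qed.

Lemma multiples_ideal d : 1 < d < m -> d %| m -> nonzero_proper_ideal (multiples d).
Proof.
move=> /andP[d1 dm] ddm; apply/andP; split.
  apply/asboolP; split.
  - by rewrite inE dvdn0.
  - rewrite inE; have -> : nat_of_ord (1%R : 'Z_m) = 1 by rewrite -[1%R]/(1%:R)%R val_Zp_nat // modn_small.
    by rewrite dvdn1 neq_ltn d1 orbT.
  - move=> a u v; rewrite !inE => du dv.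
    by rewrite val_ZpD dvdn_modm // dvdn_addl // val_ZpM dvdn_modm // dvdn_mull.
apply/eqP => /setP/(_ (d%:R%R : 'Z_m)); rewrite !inE val_Zp_nat // dvdn_modm // dvdnn.
move/esym/eqP/(congr1 val) => /=; rewrite val_Zp_nat // modn_small //; lia.
Qed.

(** The divisor d of m with I = dZ_m. *)
Definition label (I : ideal_vertex m) : nat := gcdn m (\big[gcdn/0]_(x in val I) x).

Lemma label_dvdm (I : ideal_vertex m) : label I %| m. Proof. exact: dvdn_gcdl. Qed.

Lemma label_dvd (I : ideal_vertex m) (x : 'Z_m) : x \in val I -> label I %| x.
Proof. by move=> xI; apply: dvdn_trans (dvdn_gcdr _ _) _; exact: (biggcdn_inf x). Qed.

Lemma ideal_vertexP (I : ideal_vertex m) : [/\ 0%R \in val I, 1%R \notin val I &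
  forall a u v, u \in val I -> v \in val I -> (a * u + v)%R \in val I].
Proof.
have /andP[/asboolP[h0 h1 h] _] := valP I; split => // a u v; exact: h.
Qed.

(** Bezout: the gcd is a linear combination of a and b, so it stays in the ideal.
This puts the label itself in the ideal. *)
Lemma ideal_gcd (I : ideal_vertex m) a b :
  (a%:R : 'Z_m)%R \in val I -> (b%:R : 'Z_m)%R \in val I -> (gcdn a b)%:R%R \in val I.
Proof.
have [h0 _ h] := ideal_vertexP I.
case: (posnP a) => [->|a0]; first by rewrite gcd0n.
move=> ha hb; case: (egcdnP b a0) => ka kb E _.
have -> : ((gcdn a b)%:R : 'Z_m)%R = (ka%:R * a%:R + ((- kb%:R) * b%:R + 0))%R.
  by rewrite addr0 -natrM E natrD natrM mulNr addrAC subrr add0r.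
by apply: (h _ _ _ ha); exact: (h _ _ _ hb).
Qed.

Lemma label_in (I : ideal_vertex m) : (label I)%:R%R \in val I.
Proof.
have [h0 _ h] := ideal_vertexP I.
apply: ideal_gcd; first by rewrite pchar_Zp.
apply: (big_ind (fun k => (k%:R : 'Z_m)%R \in val I)) => //; first exact: ideal_gcd.
by move=> x xI; rewrite natr_Zp.
Qed.

Lemma in_ideal (I : ideal_vertex m) (x : 'Z_m) : (x \in val I) = (label I %| x).
Proof.
apply/idP/idP => [|/dvdnP[k xk]]; first exact: label_dvd.
have [h0 _ h] := ideal_vertexP I.
by rewrite (Zp_natE x) xk natrM -[X in X \in _]addr0; apply: h; rewrite ?label_in.
Qed.

Lemma label_inj : injective label.
Proof. by move=> I J E; apply: val_inj; apply/setP => x; rewrite !in_ideal E. Qed.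

Lemma label_itv (I : ideal_vertex m) : 1 < label I < m.
Proof.
have [h0 h1 h] := ideal_vertexP I.
have lm := label_dvdm I.
have l0 : 0 < label I by rewrite (dvdn_gt0 _ lm) // ltnW.
rewrite ltn_neqAle l0 andbT ltn_neqAle (dvdn_leq _ lm) ?andbT; last exact: ltnW.
apply/andP; split; first by apply: contra h1 => /eqP E; rewrite in_ideal -E dvd1n.
have /andP[_ /negP I0] := valP I; apply/negP => /eqP E; apply: I0; apply/eqP/setP => x.
rewrite in_ideal E inE; apply/idP/eqP => [|->]; last by rewrite dvdn0.
move=> mx; apply: val_inj => /=; apply/eqP; move: mx; rewrite /dvdn modn_small //; exact: ltn_Zm.
Qed.

Lemma label_surj d : 1 < d < m -> d %| m -> exists I : ideal_vertex m, label I = d.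
Proof.
move=> dm ddm; exists (Sub (multiples d) (multiples_ideal dm ddm)); set I := Sub _ _.
have E (x : 'Z_m) : (label I %| x) = (d %| x) by rewrite -in_ideal inE.
have /andP[l1 lm] := label_itv I; have /andP[d1 dltm] := dm.
have := E (label I)%:R%R; have := E d%:R%R.
rewrite !val_Zp_nat // !modn_small // !dvdnn => h1 /esym h2.
by apply/eqP; rewrite eqn_dvd h1 h2.
Qed.

End Zm.

Section Adjacency.
Variables (m n : nat) (hm : 1 < m) (hn : 1 < n).

Lemma multiples_group d : d %| n -> group_set (multiples n d).
Proof.
move=> dn; apply/group_setP; split; first by rewrite inE dvdn0.
by move=> x y; rewrite !inE => dx dy; rewrite (val_ZpD hn) dvdn_modm // dvdn_add.
Qed.

(** Every product is divisible by the gcd; conversely, by Bezout, each multiple of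
the gcd is already a single product of the label with an element of Z_n. *)
Lemma in_ideal_mul (I : ideal_vertex m) (y : 'Z_n) :
  (y \in ideal_mul n (val I)) = (gcdn (label I) n %| y).
Proof.
set g := gcdn _ _; have gn : g %| n by exact: dvdn_gcdr.
apply/idP/idP => [|/dvdnP[k yk]].
  pose H := Group (multiples_group gn).
  suff : ideal_mul n (val I) \subset H by move/fintype.subsetP => h /h; rewrite inE.
  rewrite gen_subG; apply/fintype.subsetP => _ /imset2P[a x aI _ ->].
  rewrite inE (val_ZpM hn) dvdn_modm // dvdn_mulr //.
  rewrite val_Zp_nat // dvdn_modm //; apply: dvdn_trans (dvdn_gcdl _ _) _.
  by rewrite -in_ideal.
have /andP[l1 lm] := label_itv hm I.
have l0 : 0 < label I by lia.
case: (egcdnP n l0) => ka kb E _.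
apply: mem_gen; apply/imset2P; exists (label I)%:R%R (k * ka)%:R%R => //; first exact: label_in.
rewrite /nat_act val_Zp_nat // modn_small // -natrM (Zp_natE y) yk.
have -> : label I * (k * ka) = k * (kb * n + g) by rewrite -E mulnC mulnA.
by rewrite mulnDr natrD mulnA [X in _ = (X + _)%R]natrM (pchar_Zp hn) mulr0 add0r.
Qed.

Lemma inter_adjE (I J : ideal_vertex m) : inter_adj n I J =
  (I != J) && ~~ (n %| lcmn (gcdn (label I) n) (gcdn (label J) n)).
Proof.
rewrite /inter_adj; congr (_ && ~~ _); set g := gcdn _ n; set h := gcdn _ n.
apply/eqP/idP => [E|nl].
  have ln : lcmn g h %| n by rewrite dvdn_lcm !dvdn_gcdr.
  have : ((lcmn g h)%:R : 'Z_n)%R \in [set 0%R]%SET.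
    by rewrite -E inE !in_ideal_mul val_Zp_nat // !dvdn_modm ?dvdn_gcdr // dvdn_lcml dvdn_lcmr.
  by rewrite inE => /eqP/(congr1 val); rewrite /= val_Zp_nat // => /eqP.
apply/setP => y; rewrite !inE !in_ideal_mul -dvdn_lcm; apply/idP/eqP => [ly|->]; last by rewrite dvdn0.
have := dvdn_trans nl ly; rewrite /dvdn modn_small ?ltn_Zm // => /eqP y0.
exact: val_inj.
Qed.

(** The prime-by-prime form of adjacency, which exhibits the graph as a union of
cliques indexed by the primes dividing n. *)
Lemma inter_adjP (I J : ideal_vertex m) : reflect (I <> J /\
   exists p, [/\ prime p, logn p (label I) < logn p n & logn p (label J) < logn p n])
  (inter_adj n I J).
Proof.
rewrite inter_adjE.
have n0 : 0 < n by lia.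
have lp K : 0 < label (m := m) K by have := label_itv hm K; lia.
have g0 K : 0 < gcdn (label (m := m) K) n by rewrite gcdn_gt0 lp.
apply: (iffP andP) => -[IJ H]; split; try exact/eqP.
  apply: contrapT => nop; move/negP: H; apply.
  apply/(dvdn_partP _ n0) => p; rewrite mem_primes => /and3P[pp _ pn].
  rewrite p_part pfactor_dvdn ?lcmn_gt0 ?g0 // logn_lcm ?g0 //.
  rewrite !(logn_gcd p (lp _) n0).
  rewrite leqNgt; apply/negP; rewrite gtn_max !gtn_min !ltnn !orbF => /andP[h1 h2].
  by apply: nop; exists p.
have [p [pp hI hJ]] := H; apply/negP => /dvdn_leq_log - /(_ p).
rewrite lcmn_gt0 !g0 => /(_ isT); rewrite logn_lcm ?g0 // !(logn_gcd p (lp _) n0); lia.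
Qed.
End Adjacency.

(** * Divisor counts forced by outerplanarity *)
(** Divisors of smaller p-adic valuation than n label pairwise adjacent ideals, so
four of them would form a K4. *)
Lemma clique_le3 (R : realType) (m n p : nat) (s : seq nat) :
  1 < m -> 1 < n -> n %| m -> prime p ->
  outerplanar R (intersection_graph n m) -> uniq s ->
  (forall d, d \in s -> [/\ d %| m, d != 1 & logn p d < logn p n]) -> size s <= 3.
Proof.
move=> hm hn nm pp op us sP; rewrite leqNgt; apply/negP.
case: s us sP => [|d1 [|d2 [|d3 [|d4 s]]]] //= us sP _.
have lab d : d \in [:: d1, d2, d3, d4 & s] ->
    exists2 I : ideal_vertex m, label I = d & logn p (label I) < logn p n.
  move=> /sP[dm d1' dn].
  have m0 : 0 < m by lia.
  have d0 : 0 < d := dvdn_gt0 m0 dm.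
  have [|I E] := label_surj hm (d := d) _ dm; last by exists I; rewrite ?E.
  have dltm : d != m.
    by apply: contraTneq dn => ->; rewrite -leqNgt dvdn_leq_log.
  by move: d1' dltm (dvdn_leq m0 dm); lia.
have mem i : i < 4 -> nth 0 [:: d1, d2, d3, d4 & s] i \in [:: d1, d2, d3, d4 & s].
  by move=> i4; apply: mem_nth; rewrite /=; lia.
have [I1 E1 h1] := lab _ (mem 0 isT); have [I2 E2 h2] := lab _ (mem 1 isT).
have [I3 E3 h3] := lab _ (mem 2 isT); have [I4 E4 h4] := lab _ (mem 3 isT).
rewrite /= in E1 E2 E3 E4.
have adj (I J : ideal_vertex m) : label I != label J -> logn p (label I) < logn p n ->
    logn p (label J) < logn p n -> sadj (s := intersection_graph n m) I J.
  by move=> IJ hI hJ; apply/(inter_adjP hm hn); split; [move=> E; rewrite E eqxx in IJ|exists p].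
move: us; rewrite !inE !negb_or => /and5P[/and4P[n12 n13 n14 _] /and3P[n23 n24 _] /andP[n34 _] _ _].
apply: (@K4_not_outerplanar R (intersection_graph n m) I1 I2 I3 I4) op; apply: adj => //; by rewrite ?E1 ?E2 ?E3 ?E4.
Qed.

Lemma logn_coprimeM p i f : prime p -> ~~ (p %| f) -> logn p (p ^ i * f) = i.
Proof.
move=> pp pf; have f0 : 0 < f by case: f pf => //; rewrite dvdn0.
have p0 : 0 < p ^ i by rewrite expn_gt0 prime_gt0.
by rewrite (lognM _ p0 f0) pfactorK // lognE pp f0 (negbTE pf) addn0.
Qed.

(** The products p^i f with i < b and f dividing e, except 1, are labels of one
clique, and there are b tau(e) - 1 of them. *)
Lemma divisors_bound (R : realType) (m n p a b e n' : nat) :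
  1 < m -> 1 < n -> n %| m -> outerplanar R (intersection_graph n m) ->
  prime p -> m = p ^ a * e -> n = p ^ b * n' -> ~~ (p %| e) -> n' %| e -> b <= a ->
  b * size (divisors e) <= 4.
Proof.
move=> hm hn nm op pp mE nE pe n'e ba.
have p0 := prime_gt0 pp.
have e0 : 0 < e by case: (e) pe => //; rewrite dvdn0.
have pf f : f %| e -> ~~ (p %| f) by move=> fe; apply: contra pe => /dvdn_trans; apply.
have lE i f : f %| e -> logn p (p ^ i * f) = i by move=> /pf; exact: logn_coprimeM.
pose s := [seq p ^ i * f | i <- iota 0 b, f <- divisors e].
have us : uniq s.
  apply: allpairs_uniq; [exact: iota_uniq|exact: divisors_uniq|].
  move=> [i f] [j h] /allpairsP[[i1 f1] /= [_ f1e [_ E1]]] /allpairsP[[i2 f2] /= [_ f2e [_ E2]]] /= E.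
  rewrite -dvdn_divisors // in f1e; rewrite -dvdn_divisors // in f2e.
  rewrite -{}E1 in f1e; rewrite -{}E2 in f2e.
  have ij : i = j by rewrite -(lE i f) // E lE.
  by move/eqP: E; rewrite ij eqn_pmul2l ?expn_gt0 ?p0 // => /eqP->.
have ss : size s = b * size (divisors e) by rewrite size_allpairs size_iota.
rewrite -ss; have := @clique_le3 R m n p (rem 1 s) hm hn nm pp op (rem_uniq _ us).
have nE' : logn p n = b by rewrite nE lE.
have h d : d \in rem 1 s -> [/\ d %| m, d != 1 & logn p d < logn p n].
  rewrite mem_rem_uniq // inE => /andP[d1 /allpairsP[[i f] /= [ib fe dE]]].
  rewrite dE in d1 *.
  rewrite mem_iota add0n /= in ib; rewrite -dvdn_divisors // in fe.
  rewrite nE' lE // d1 mE; split => //; apply: dvdn_mul => //.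
  by apply: dvdn_exp2l; lia.
move=> /(_ h) {}h; move: h; clear -us.
case s1 : (1 \in s); first by rewrite size_rem //; case: (size s) => [|k] /=; lia.
by rewrite rem_id ?s1 //; lia.
Qed.

Lemma divisors_ge (e : nat) (s : seq nat) : 0 < e -> uniq s -> (forall d, d \in s -> d %| e) ->
  size s <= size (divisors e).
Proof. by move=> e0 us sP; apply: uniq_leq_size us _ => d /sP; rewrite dvdn_divisors. Qed.

Lemma size_divisors_pow p a : prime p -> a < size (divisors (p ^ a)).
Proof.
move=> pp; have := @divisors_ge (p ^ a) [seq p ^ i | i <- iota 0 a.+1].
rewrite size_map size_iota; apply; first by rewrite expn_gt0 prime_gt0.
  rewrite map_inj_uniq ?iota_uniq // => i j /eqP.
  by rewrite eqn_exp2l ?prime_gt1 // => /eqP.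
move=> d /mapP[i]; rewrite mem_iota add0n => /andP[_ ia] ->.
by apply: dvdn_exp2l; lia.
Qed.

Lemma size_divisors_powM p a r : prime p -> prime r -> p != r -> 1 < a ->
  4 < size (divisors (p ^ a * r)).
Proof.
move=> pp pr npr a1; have p1 := prime_gt1 pp; have r1 := prime_gt1 pr.
have d2 : p ^ 2 %| p ^ a by exact: dvdn_exp2l.
have d1 : p %| p ^ 2 by rewrite dvdn_mulr.
have d1a := dvdn_trans d1 d2.
have nrp : r != p ^ 2.
  apply/eqP => E; have : p %| r by rewrite E.
  by rewrite dvdn_prime2 // (negbTE npr).
apply: (@divisors_ge _ [:: 1; p; p ^ 2; r; p * r]).
- by rewrite muln_gt0 expn_gt0 (ltnW p1) (ltnW r1).
- by rewrite /= !inE !negb_or; move: npr nrp; rewrite -mulnn; nia.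
- move=> d; rewrite !inE => /or4P[/eqP->|/eqP->|/eqP->|/orP[]/eqP->].
  + exact: dvd1n.
  + by rewrite dvdn_mulr.
  + by rewrite dvdn_mulr.
  + by rewrite dvdn_mull.
  + by rewrite dvdn_mul.
Qed.

(** With q a prime factor of e, write e = q^k f.  If f is neither 1 nor the
prime r = pdiv f, or if f <> 1 and k > 1, five divisors can be exhibited. *)
Lemma few_divisors e : 0 < e -> size (divisors e) <= 4 ->
  [\/ e = 1, exists q k, [/\ prime q, 0 < k <= 3 & e = q ^ k] |
      exists q r, [/\ prime q, prime r, q != r & e = q * r]].
Proof.
move=> e0 se; have [e1|e1] := leqP e 1; first by constructor 1; lia.
have qp := pdiv_prime e1; set q := pdiv e in qp.
have q1 := prime_gt1 qp; have qe : q %| e := pdiv_dvd e.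
have [f qf eE] := pfactor_coprime qp e0; set k := logn q e in eE.
have k0 : 0 < k by rewrite logn_gt0 mem_primes qp e0.
rewrite mulnC in eE; have f0 : 0 < f by case: (f) eE e0 => // ->; rewrite muln0.
have {}qf : ~~ (q %| f) by rewrite -prime_coprime.
have [f1|f1] := leqP f 1.
  have fE : f = 1 by lia.
  constructor 2; exists q, k; split => //; last by rewrite {1}eE fE muln1.
  by have := size_divisors_pow k qp; rewrite k0 /= -[q ^ k]muln1 -fE -eE; lia.
have rp := pdiv_prime f1; set r := pdiv f in rp; have rf : r %| f := pdiv_dvd f.
have r1 := prime_gt1 rp.
have qr : q != r by apply: contra qf => /eqP ->.
have mono d : d %| e -> size (divisors d) <= size (divisors e).
  move=> de; apply: divisors_ge => //; first exact: divisors_uniq.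
  by move=> h; rewrite -dvdn_divisors ?(dvdn_gt0 e0) // => /dvdn_trans; apply.
have k1 : k = 1.
  apply/eqP; rewrite eqn_leq k0 andbT leqNgt; apply/negP => k2.
  have := size_divisors_powM qp rp qr k2.
  have /mono : q ^ k * r %| e by rewrite eE dvdn_mul.
  lia.
constructor 3; exists q, r; split => //; rewrite {1}eE k1 expn1; congr (_ * _).
apply/eqP/negPn/negP => fr.
rewrite k1 expn1 in eE.
have : size [:: 1; q; r; f; q * r] <= size (divisors e).
  apply: divisors_ge => //.
    have qnf : q != f by apply: contra qf => /eqP <-.
    have fqr : f != q * r by apply: contra qf => /eqP ->; rewrite dvdn_mulr.
    by rewrite /= !inE !negb_or; nia.
  move=> d; rewrite !inE => /or4P[/eqP->|/eqP->|/eqP->|/orP[]/eqP->] //.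
  - by rewrite eE dvdn_mull.
  - by rewrite eE dvdn_mull.
  - by rewrite eE dvdn_mul.
by rewrite /=; lia.
Qed.

Lemma pfactor_split p n : prime p -> 0 < n -> exists a e,
  [/\ n = p ^ a * e, ~~ (p %| e) & a = logn p n].
Proof.
move=> pp n0; have [e pe nE] := pfactor_coprime pp n0.
by exists (logn p n), e; rewrite mulnC -nE -prime_coprime.
Qed.

Lemma dvdn_pfactor_mul p a e d : prime p -> ~~ (p %| e) -> 0 < e -> d %| p ^ a * e ->
  exists i f, [/\ d = p ^ i * f, i <= a, i = logn p d & f %| e].
Proof.
move=> pp pe e0 dd; have p0 := prime_gt0 pp.
have m0 : 0 < p ^ a * e by rewrite muln_gt0 expn_gt0 p0 e0.
have d0 := dvdn_gt0 m0 dd.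
have [i [f [dE pf iE]]] := pfactor_split pp d0.
exists i, f; split => //; first by rewrite iE -(logn_coprimeM a pp pe) dvdn_leq_log.
have : f %| p ^ a * e by apply: dvdn_trans dd; rewrite dE dvdn_mull.
by rewrite Gauss_dvdr // coprime_sym coprimeXl // prime_coprime.
Qed.

Lemma prime_avoid (k l : nat) : exists2 p, prime p & p <> k /\ p <> l.
Proof.
have [p pkl pp] := prime_above (k + l); exists p => //; lia.
Qed.

(** * Solving the divisor inequalities *)
(** The right-hand side of the classification, named so that its two implications
can be stated separately. *)
Definition listed (m n : nat) : Prop :=
  exists p1 p2 p3 a1 a2 b1 : nat,
    [/\ prime p1, prime p2 & prime p3] /\
    [/\ p1 <> p2, p1 <> p3 & p2 <> p3] /\
    [/\ 0 < a1, 0 < a2 & 0 < b1] /\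
    ( [/\ m = p1 ^ a1, n = p1 ^ b1 & b1 <= 4]
      \/ [/\ m = p1 ^ a1 * p2 ^ a2, n = p1 & a2 <= 3]
      \/ (m = p1 ^ a1 * p2 /\ n = p1 ^ 2)
      \/ (m = p1 ^ a1 * p2 * p3 /\ n = p1)
      \/ [/\ m = p1 * p2 ^ a2, n = p1 * p2 ^ 2 & a2 = 2 \/ a2 = 3]
      \/ (m = p1 * p2 * p3 /\ n = p1 * p2)
      \/ [/\ m = p1 ^ a1 * p2 ^ a2, n = p1 * p2 & a1 <= 3 /\ a2 <= 3]
      \/ (m = p1 * p2 * p3 /\ n = p1 * p2 * p3) ).

(** Apply the inequality first at the smallest prime factor p of n; it bounds b
and leaves 1, q^k or qr for the part e of m prime to p.  If n has further prime
factors, the inequality at those bounds the exponent a of p in m. *)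
Lemma listed_of_bounds m n : 1 < m -> 1 < n -> n %| m ->
  (forall p a b e n', prime p -> m = p ^ a * e -> n = p ^ b * n' -> ~~ (p %| e) ->
    n' %| e -> b <= a -> b * size (divisors e) <= 4) -> listed m n.
Proof.
move=> hm hn nm H.
pose p := pdiv n; have pp : prime p := pdiv_prime hn.
have pn : p %| n := pdiv_dvd n.
have [a [e [mE pe aE]]] := pfactor_split pp (ltnW hm).
have [b [n' [nE pn' bE]]] := pfactor_split pp (ltnW hn).
have b0 : 0 < b by rewrite bE logn_gt0 mem_primes pp pn ltnW.
have ba : b <= a by rewrite bE aE dvdn_leq_log // ltnW.
have e0 : 0 < e by case: (e) pe => //; rewrite dvdn0.
have n'e : n' %| e.
  have : n' %| p ^ a * e by rewrite -mE; apply: dvdn_trans nm; rewrite nE dvdn_mull.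
  by rewrite Gauss_dvdr // coprime_sym coprimeXl // prime_coprime.
have Hp := H _ _ _ _ _ pp mE nE pe n'e ba.
have a0 := leq_trans b0 ba.
have [p2 pp2 [p2p _]] := prime_avoid p p; have [p3 pp3 [p3p p32]] := prime_avoid p p2.
have /few_divisors : size (divisors e) <= 4 by exact: leq_trans (leq_pmull _ b0) Hp.
case=> [//|e1|[q [k [qp /andP[k0 k3] eE]]]|[q [r [qp rp qr eE]]]].
- have n1 : n' = 1 by apply/eqP; rewrite -dvdn1 -e1.
  exists p, p2, p3, a, 1, b; do 3![split; first by split; auto]; left.
  rewrite mE nE e1 n1 !muln1; split => //.
  by move: Hp; rewrite e1 (_ : size (divisors 1) = 1) // muln1.
- have pq : p <> q by move=> E; move: pe; rewrite eE E dvdn_exp.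
  have [r rp [r1 r2]] := prime_avoid p q.
  have qpa i : ~~ (q %| p ^ i).
    by rewrite Euclid_dvdX // dvdn_prime2 // eq_sym; move/eqP/negbTE: pq => ->.
  have [j jk n'E] : exists2 j, j <= k & n' = q ^ j.
    by apply/dvdn_pfactor => //; rewrite -eE.
  have sk : k < size (divisors e) by rewrite eE size_divisors_pow.
  have sa : a < size (divisors (p ^ a)) by exact: size_divisors_pow.
  have Hq : j * size (divisors (p ^ a)) <= 4.
    apply: (H q k j (p ^ a) (p ^ b)) => //; rewrite ?mE ?nE ?eE ?n'E; try exact: mulnC.
    exact: dvdn_exp2l.
  have le4 c s t : c * s <= 4 -> t <= s -> c * t <= 4.
    by move=> cs ts; apply: leq_trans cs; rewrite leq_mul2l ts orbT.
  have Hpk := le4 _ _ _ Hp sk; have Hqa := le4 _ _ _ Hq sa.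
  have Hp2 : b * 2 <= 4 by exact: le4 Hpk _.
  have Hq2 : j * 2 <= 4 by exact: le4 Hqa _.
  have [b1|b2] : b = 1 \/ b = 2 by move: b0 Hp2; clear; lia.
    rewrite b1 mul1n in Hpk.
    have [j0|[j1|j2]] : j = 0 \/ j = 1 \/ j = 2 by move: Hq2; clear; lia.
    + exists p, q, r, a, k, 1; do 3![split; first by split; auto]; right; left.
      by rewrite mE nE eE n'E b1 j0 muln1 expn1.
    + exists p, q, r, a, k, 1; do 3![split; first by split; auto]; do 6!right; left.
      rewrite mE nE eE n'E b1 j1 !expn1; split => //; split => //.
      by move: Hqa; rewrite j1 mul1n; clear; lia.
    + have a1 : a = 1 by move: Hqa a0; rewrite j2; clear; lia.
      exists p, q, r, a, k, 1; do 3![split; first by split; auto]; do 4!right; left.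
      rewrite mE nE eE n'E b1 j2 a1 !expn1; split => //.
      by move: jk Hpk; rewrite j2; clear; lia.
  have k1 : k = 1 by move: Hpk k0; rewrite b2; clear; lia.
  have [j0|j1] : j = 0 \/ j = 1 by move: jk; rewrite k1; clear; lia.
    exists p, q, r, a, 1, 1; do 3![split; first by split; auto]; do 2!right; left.
    by rewrite mE nE eE n'E b2 j0 k1 muln1 expn1.
  exists q, p, r, 1, a, 1; do 3![split; first by split; auto]; do 4!right; left.
  rewrite mE nE eE n'E b2 j1 k1 !expn1; split; [exact: mulnC|exact: mulnC|].
  by move: ba Hqa; rewrite j1 b2; clear; lia.
- have pq : p <> q by move=> E; move: pe; rewrite eE E dvdn_mulr.
  have pr : p <> r by move=> E; move: pe; rewrite eE E dvdn_mull.
  have {}qr : q <> r by apply/eqP.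
  have sq : 4 <= size (divisors e).
    have [q1 r1] := (prime_gt1 qp, prime_gt1 rp).
    apply: (@divisors_ge _ [:: 1; q; r; q * r]); first by rewrite eE muln_gt0; lia.
      by rewrite /= !inE !negb_or; move: qr q1 r1; clear; nia.
    move=> d; rewrite eE !inE => /or4P[]/eqP->;
      first [exact: dvd1n|exact: dvdn_mulr|exact: dvdn_mull|exact: dvdnn].
  have b1 : b = 1.
    by move: b0 (leq_trans (leq_mul (leqnn b) sq) Hp); clear; lia.
  have a1 s t c : prime s -> prime t -> p <> s -> p <> t -> s <> t -> e = s * t ->
    n' = s * c -> c %| t -> a = 1.
    move=> sp tp ps pt st est n'c ct; apply/eqP; rewrite eqn_leq a0 andbT leqNgt; apply/negP => a2.
    have pt' : p != t by apply/eqP.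
    have := size_divisors_powM pp tp pt' a2.
    rewrite ltnNge => /negP; apply; rewrite -[size _]mul1n.
    apply: (H s 1 1 (p ^ a * t) (p * c)) => //.
    - by rewrite mE est expn1 mulnCA.
    - by rewrite nE n'c b1 !expn1 mulnCA.
    - rewrite Euclid_dvdM // Euclid_dvdX // !dvdn_prime2 //.
      by rewrite negb_or negb_and; apply/andP; split; [apply/orP; left|]; apply/eqP => ?; auto.
    - by rewrite dvdn_mul // -[p in p %| _]expn1 dvdn_exp2l.
  have cn : n' = 1 \/ n' = q \/ n' = r \/ n' = q * r.
    have [i [f [fE i1 _ fr]]] : exists i f, [/\ n' = q ^ i * f, i <= 1, i = logn q n' & f %| r].
      apply: dvdn_pfactor_mul; rewrite ?expn1 -?eE ?prime_gt0 //.
      by rewrite dvdn_prime2 //; apply/eqP.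
    have fE' : f = 1 \/ f = r.
      by have [_ h] := primeP rp; have /orP[/eqP->|/eqP->] := h _ fr; auto.
    case: i i1 fE => [|[|//]] _; rewrite ?expn0 ?mul1n ?expn1 => ->.
      by case: fE' => ->; auto.
    by case: fE' => ->; rewrite ?muln1; auto.
  have nn : n = p * n' by rewrite nE b1 expn1.
  have mm : m = p ^ a * q * r by rewrite mE eE mulnA.
  case: cn => [n1|[nq|[nr|nqr]]].
  + exists p, q, r, a, 1, 1; do 3![split; first by split; auto]; do 3!right; left.
    by rewrite nn n1 muln1.
  + have aa : a = 1 by apply: (a1 q r 1); rewrite ?muln1.
    exists p, q, r, a, 1, 1; do 3![split; first by split; auto]; do 5!right; left.
    by rewrite nn nq mm aa expn1.
  + have aa : a = 1 by apply: (a1 r q 1); rewrite ?muln1 ?dvd1n //; [auto|rewrite mulnC].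
    exists p, r, q, a, 1, 1; do 3![split; first by split; auto]; do 5!right; left.
    by rewrite nn nr mm aa expn1 mulnAC.
  + have aa : a = 1 by apply: (a1 q r r).
    exists p, q, r, a, 1, 1; do 3![split; first by split; auto]; do 7!right.
    by rewrite nn nqr mm aa expn1 mulnA.
Qed.

(** * Cliques of the admissible pairs *)
(** Membership in the clique attached to p. *)
Definition low m n p d := [&& d %| m, 1 < d & logn p d < logn p n].

(** The shapes of the cliques: [pows q] occurs for the valuation-0 divisors of
p^a q^c with c <= 3, or for those of a prime power, and [trio q r] for the
products of nonempty sets of two primes. *)
Definition pows q := [:: q; q ^ 2; q ^ 3].
Definition trio q r := [:: q; r; q * r].

Lemma low_split m n p a e d : prime p -> m = p ^ a * e -> ~~ (p %| e) -> low m n p d ->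
  exists i f, [/\ d = p ^ i * f, i < logn p n, f %| e & 1 < d].
Proof.
move=> pp mE pe /and3P[dm d1 dn].
have e0 : 0 < e by case: (e) pe => //; rewrite dvdn0.
have [|i [f [dE _ iE fe]]] := @dvdn_pfactor_mul p a e d pp pe e0; first by rewrite -mE.
by exists i, f; split; rewrite -?iE // iE.
Qed.

Lemma in_pows q j : 1 < q ^ j -> j <= 3 -> q ^ j \in pows q.
Proof. by case: j => [|[|[|[|//]]]] // _ _; rewrite !inE ?expn1 eqxx ?orbT. Qed.

Lemma dvd_prime q f : prime q -> f %| q -> f = 1 \/ f = q.
Proof. by move=> /primeP[_ h] /h /orP[]/eqP; auto. Qed.

Lemma low_pow_prime m n p a d : prime p -> m = p ^ a -> logn p n <= 4 -> low m n p d ->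
  d \in pows p.
Proof.
move=> pp mE n4 /(@low_split _ _ p a 1 d pp).
rewrite muln1 dvdn1 neq_ltn prime_gt1 // orbT => /(_ mE isT)[i [f [dE ip f1 d1]]].
have fE : f = 1 by apply/eqP; rewrite -dvdn1.
move: d1; rewrite dE fE muln1 => d1; apply: in_pows => //; lia.
Qed.

Section TwoPrimes.
Variables p q : nat.
Hypotheses (pp : prime p) (qp : prime q) (pq : p <> q).

Lemma prime_ndvd : ~~ (p %| q).
Proof. by rewrite dvdn_prime2 //; apply/eqP. Qed.

Lemma prime_ndvdX k : ~~ (p %| q ^ k).
Proof. by rewrite Euclid_dvdX // negb_and prime_ndvd. Qed.

Lemma low_coprime_pow m n a c d : m = p ^ a * q ^ c -> c <= 3 -> logn p n = 1 -> low m n p d ->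
  d \in pows q.
Proof.
move=> mE c3 n1 /(low_split pp mE (prime_ndvdX c))[i [f [dE ip fq d1]]].
rewrite n1 in ip; have i0 : i = 0 by lia.
have /(dvdn_pfactor _ _ qp)[j jc fE] := fq.
move: d1; rewrite dE i0 mul1n fE => d1; apply: in_pows => //; lia.
Qed.

Lemma low_trio m n a d : m = p ^ a * q -> logn p n <= 2 -> low m n p d -> d \in trio p q.
Proof.
move=> mE n2 /(low_split pp mE prime_ndvd)[i [f [dE ip /(dvd_prime qp) fq d1]]].
move: d1; have [i0|i1] : i = 0 \/ i = 1 by lia.
  by case: fq dE => ->; rewrite i0 mul1n => -> // _; rewrite !inE eqxx orbT.
by case: fq dE => ->; rewrite i1 expn1 ?muln1 => -> // _; rewrite !inE eqxx ?orbT.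
Qed.

Lemma pows_ndvd w : w \in pows q -> ~~ (p %| w).
Proof. by rewrite !inE => /or3P[]/eqP->; rewrite ?prime_ndvdX ?prime_ndvd. Qed.

Lemma pows_dvd w : w \in pows q -> q %| w.
Proof. by rewrite !inE => /or3P[]/eqP->; rewrite ?dvdn_exp. Qed.

Lemma trio_dvdl w : w \in trio p q -> w <> q -> p %| w.
Proof. by rewrite !inE => /or3P[]/eqP-> // _; rewrite dvdn_mulr. Qed.

Lemma trio_dvdr w : w \in trio p q -> w <> p -> q %| w.
Proof. by rewrite !inE => /or3P[]/eqP-> // _; rewrite dvdn_mull. Qed.
End TwoPrimes.

Section ThreePrimes.
Variables p q r : nat.
Hypotheses (pp : prime p) (qp : prime q) (rp : prime r) (pq : p <> q) (pr : p <> r).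

Lemma trio_ndvd w : w \in trio q r -> ~~ (p %| w).
Proof.
by rewrite !inE => /or3P[]/eqP->; rewrite ?Euclid_dvdM ?negb_or // ?(prime_ndvd pp qp) ?(prime_ndvd pp rp).
Qed.

Lemma low_coprime_trio m n a d : m = p ^ a * (q * r) -> logn p n = 1 -> low m n p d ->
  d \in trio q r.
Proof.
have pqr : ~~ (p %| q * r) by apply: trio_ndvd; rewrite !inE eqxx !orbT.
move=> mE n1 /(low_split pp mE pqr)[i [f [dE ip fqr d1]]].
have i0 : i = 0 by lia.
move: d1; rewrite dE i0 mul1n {i0 ip dE} => f1.
have [fq|fq] := boolP (coprime f q).
  have : f %| r by rewrite -(Gauss_dvdr _ fq).
  by case/(dvd_prime rp) => fE; move: f1; rewrite fE // !inE eqxx orbT.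
have {}fq : q %| f by rewrite coprime_sym prime_coprime // negbK in fq.
have /dvdnP[g fE] := fq; have q0 := prime_gt0 qp.
move: fqr; rewrite fE mulnC dvdn_pmul2l // => /(dvd_prime rp)[]->.
  by rewrite muln1 !inE eqxx.
by rewrite !inE eqxx !orbT.
Qed.
End ThreePrimes.

Lemma notin0 p (A : seq nat) : (forall w, w \in A -> ~~ (p %| w)) -> 0 \notin A.
Proof. by move=> h; apply/negP => /h; rewrite dvdn0. Qed.

Section Converse.
Variables (R : realType) (m n : nat) (hm : 1 < m) (hn : 1 < n).
Let G := intersection_graph n m.

Lemma adj_low (I J : G) : sadj I J -> exists p,
  [/\ prime p, p %| n, low m n p (label I) & low m n p (label J)].
Proof.
move=> /(inter_adjP hm hn)[_ [p [pp hI hJ]]].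
have /andP[I1 _] := label_itv hm I; have /andP[J1 _] := label_itv hm J.
exists p; rewrite /low !label_dvdm I1 J1 hI hJ; split => //.
have : 0 < logn p n by lia.
by rewrite logn_gt0 mem_primes => /and3P[].
Qed.

Lemma one_clique p A : (forall l, prime l -> l %| n -> l = p) -> size A <= 3 -> 0 \notin A ->
  (forall d, low m n p d -> d \in A) -> outerplanar R G.
Proof.
move=> np sA A0 hA.
apply: (@two_cliques_outerplanar R G (label (m := m)) A [::] 0) => //; first exact: label_inj.
by move=> I J /adj_low[l [lp /(np _ lp)-> /hA hI /hA hJ]]; left.
Qed.

Lemma two_cliques p q A B x : (forall l, prime l -> l %| n -> l = p \/ l = q) ->
  size A <= 3 -> size B <= 3 -> 0 \notin A -> 0 \notin B ->
  (forall w, w \in A -> w \in B -> w = x) ->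
  (forall d, low m n p d -> d \in A) -> (forall d, low m n q d -> d \in B) -> outerplanar R G.
Proof.
move=> np sA sB A0 B0 AB hA hB.
apply: (@two_cliques_outerplanar R G (label (m := m)) A B x) => //; first exact: label_inj.
move=> I J /adj_low[l [lp /(np _ lp)[]-> hI hJ]]; [left|right]; auto.
Qed.
End Converse.

(** In the first four families n is a prime power, giving one clique; in the next three there
are two, sharing at most one vertex; in the last there are three, pairwise sharing
one prime. *)
Lemma outerplanar_of_listed (R : realType) m n : 1 < m -> 1 < n -> listed m n ->
  outerplanar R (intersection_graph n m).
Proof.
move=> hm hn [p [q [r [a [c [b [[pp qp rp] [[pq pr qr] [[a0 c0 b0] H]]]]]]]]].
have qp' : q <> p by auto. have rp' : r <> p by auto. have rq' : r <> q by auto.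
have p1 := prime_gt1 pp; have q1 := prime_gt1 qp; have r1 := prime_gt1 rp.
have only1 k : n = p ^ k -> forall l, prime l -> l %| n -> l = p.
  by move=> -> l lp; rewrite Euclid_dvdX // dvdn_prime2 // => /andP[/eqP].
have only2 i j : n = p ^ i * q ^ j -> forall l, prime l -> l %| n -> l = p \/ l = q.
  move=> -> l lp; rewrite Euclid_dvdM // !Euclid_dvdX // !dvdn_prime2 //.
  by case/orP => /andP[/eqP]; auto.
have lp x i j : prime x -> ~~ (x %| j) -> n = x ^ i * j -> logn x n = i.
  by move=> xp xj ->; exact: logn_coprimeM.
have ndvd := prime_ndvd.
have ndvd1 x : prime x -> ~~ (x %| 1) by move=> xp; rewrite dvdn1 neq_ltn prime_gt1 // orbT.
case: H => [[mE nE b4]|[[mE nE c3]|[[mE nE]|[[mE nE]|[[mE nE c23]|[[mE nE]|[[mE nE [a3 c3]]|[mE nE]]]]]]]].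
- apply: (@one_clique R m n hm hn p (pows p)) => //; first exact: only1 nE.
    exact: notin0 (pows_ndvd qp pp qp').
  by move=> d; apply: (low_pow_prime pp mE); rewrite (lp p b 1) ?muln1 ?ndvd1.
- apply: (@one_clique R m n hm hn p (pows q)) => //; first by apply: (only1 1); rewrite expn1.
    exact: notin0 (pows_ndvd pp qp pq).
  by move=> d; apply: (low_coprime_pow pp qp pq mE) => //; rewrite (lp p 1 1) ?muln1 ?ndvd1.
- apply: (@one_clique R m n hm hn p (trio p q)) => //; first exact: only1 nE.
    by apply: notin0; apply: (trio_ndvd rp pp qp) => //.
  by move=> d; apply: (low_trio pp qp pq mE) => //; rewrite (lp p 2 1) ?muln1 ?ndvd1.
- apply: (@one_clique R m n hm hn p (trio q r)) => //; first by apply: (only1 1); rewrite expn1.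
    by apply: notin0; apply: (trio_ndvd pp qp rp) => //.
  move=> d; apply: (low_coprime_trio (a := a) pp qp rp pq pr); first by rewrite mE mulnA.
  by rewrite (lp p 1 1) ?muln1 ?ndvd1.
- apply: (@two_cliques R m n hm hn p q (pows q) (trio q p) q) => //.
  + by apply: (only2 1 2); rewrite expn1.
  + exact: notin0 (pows_ndvd pp qp pq).
  + by apply: notin0; apply: (trio_ndvd rp qp pp) => //.
  + move=> w /(pows_ndvd pp qp pq) pw wB; apply: contrapT => wq.
    by move/negP: pw; apply; exact: trio_dvdr wB wq.
  + move=> d; apply: (low_coprime_pow (a := 1) (c := c) pp qp pq); rewrite ?expn1 //; first by case: c23 => ->.
    by rewrite (lp p 1 (q ^ 2)) ?expn1 ?prime_ndvdX.
  + move=> d; apply: (low_trio (a := c) qp pp qp'); first by rewrite mE mulnC.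
    by rewrite (lp q 2 p) ?ndvd // mulnC.
- apply: (@two_cliques R m n hm hn p q (trio q r) (trio p r) r) => //.
  + by apply: (only2 1 1); rewrite !expn1.
  + by apply: notin0; apply: (trio_ndvd pp qp rp) => //.
  + by apply: notin0; apply: (trio_ndvd qp pp rp) => //.
  + move=> w /(trio_ndvd pp qp rp pq pr) pw wB; apply: contrapT => wr.
    by move/negP: pw; apply; exact: trio_dvdl wB wr.
  + move=> d; apply: (low_coprime_trio (a := 1) pp qp rp pq pr); first by rewrite mE expn1 mulnA.
    by rewrite (lp p 1 q) ?expn1 ?ndvd.
  + move=> d; apply: (low_coprime_trio (a := 1) qp pp rp qp' qr); first by rewrite mE expn1 mulnCA mulnA.
    by rewrite (lp q 1 p) ?expn1 ?ndvd // mulnC.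
- apply: (@two_cliques R m n hm hn p q (pows q) (pows p) 0) => //.
  + by apply: (only2 1 1); rewrite !expn1.
  + exact: notin0 (pows_ndvd pp qp pq).
  + exact: notin0 (pows_ndvd qp pp qp').
  + by move=> w /(pows_ndvd pp qp pq)/negP pw /pows_dvd.
  + move=> d; apply: (low_coprime_pow pp qp pq mE) => //.
    by rewrite (lp p 1 q) ?expn1 ?ndvd.
  + move=> d; apply: (low_coprime_pow (a := c) (c := a) qp pp qp') => //; first by rewrite mE mulnC.
    by rewrite (lp q 1 p) ?expn1 ?ndvd // mulnC.
- apply: (@sun_outerplanar R (intersection_graph n m) (label (m := m)) (trio q r) (trio p r) (trio p q) r p q) => //.
  + exact: label_inj.
  + move=> w /(trio_ndvd pp qp rp pq pr) pw wB; apply: contrapT => wr.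
    by move/negP: pw; apply; exact: trio_dvdl wB wr.
  + move=> w /(trio_ndvd qp pp rp qp' qr) qw wB; apply: contrapT => wp.
    by move/negP: qw; apply; exact: trio_dvdr wB wp.
  + move=> w /(trio_ndvd rp pp qp rp' rq') rw wB; apply: contrapT => wq.
    by move/negP: rw; apply; exact: trio_dvdr wB wq.
  + by apply/negP => /(trio_ndvd pp qp rp pq pr); rewrite dvdnn.
  + by apply/negP => /(trio_ndvd qp pp rp qp' qr); rewrite dvdnn.
  + by apply/negP => /(trio_ndvd rp pp qp rp' rq'); rewrite dvdnn.
  move=> I J /(adj_low hm hn)[l [lpr]].
  rewrite {1}nE Euclid_dvdM // Euclid_dvdM // !dvdn_prime2 // => /orP[/orP[]|] /eqP-> hI hJ.
  + have hp : forall d, low m n p d -> d \in trio q r.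
      move=> d; apply: (low_coprime_trio (a := 1) pp qp rp pq pr); first by rewrite mE expn1 mulnA.
      by rewrite (lp p 1 (q * r)) ?expn1 ?mulnA // Euclid_dvdM // negb_or !ndvd.
    by constructor 1; auto.
  + have hp : forall d, low m n q d -> d \in trio p r.
      move=> d; apply: (low_coprime_trio (a := 1) qp pp rp qp' qr); first by rewrite mE expn1 mulnCA mulnA.
      by rewrite (lp q 1 (p * r)) ?nE ?expn1 1?mulnCA ?mulnA // Euclid_dvdM // negb_or !ndvd.
    by constructor 2; auto.
  + have hp : forall d, low m n r d -> d \in trio p q.
      move=> d; apply: (low_coprime_trio (a := 1) rp pp qp rp' rq'); first by rewrite mE expn1 mulnC.
      by rewrite (lp r 1 (p * q)) ?expn1 1?mulnC // Euclid_dvdM // negb_or !ndvd.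
    by constructor 3; auto.
Qed.

Theorem theorem3 (R : realType) (m n : nat) (hm : 1 < m) (hn : 1 < n)
    (hnm : n %| m) :
  outerplanar R (intersection_graph n m) <->
  exists p1 p2 p3 a1 a2 b1 : nat,
    [/\ prime p1, prime p2 & prime p3] /\
    [/\ p1 <> p2, p1 <> p3 & p2 <> p3] /\
    [/\ 0 < a1, 0 < a2 & 0 < b1] /\
    ( [/\ m = p1 ^ a1, n = p1 ^ b1 & b1 <= 4]
      \/ [/\ m = p1 ^ a1 * p2 ^ a2, n = p1 & a2 <= 3]
      \/ (m = p1 ^ a1 * p2 /\ n = p1 ^ 2)
      \/ (m = p1 ^ a1 * p2 * p3 /\ n = p1)
      \/ [/\ m = p1 * p2 ^ a2, n = p1 * p2 ^ 2 & a2 = 2 \/ a2 = 3]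
      \/ (m = p1 * p2 * p3 /\ n = p1 * p2)
      \/ [/\ m = p1 ^ a1 * p2 ^ a2, n = p1 * p2 & a1 <= 3 /\ a2 <= 3]
      \/ (m = p1 * p2 * p3 /\ n = p1 * p2 * p3) ).
Proof.
split=> [op|]; last exact: outerplanar_of_listed.
apply: (listed_of_bounds hm hn hnm) => p a b e n' pp mE nE pe n'e ba.
exact: divisors_bound op pp mE nE pe n'e ba.
Qed.
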